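(* Let $X=(X_t)_{t\ge0}$ be a real-valued Lévy process with Lévy measure $\Pi$. Suppose $\overline{\Pi}^+(0+)=\infty$ and $\overline{\Pi}^-(0+)=\infty$. For (1) assume $\sum_{0<s\le t}\Delta X_s^-$ is finite a.s., for (2) assume $\sum_{0<s\le t}\Delta X_s^+$ is finite a.s., and for (3) assume both are finite a.s. Then the following hold, all limits of random quantities being in probability as $t\downarrow0$: (1) $\displaystyle\frac{\sum_{0<s\le t}\Delta X_s^-}{\sup_{0<s\le t}\Delta X_s^+}\to0$ if and only if $\displaystyle\lim_{x\downarrow0}\frac{\int_0^x\overline{\Pi}^-(y)\,dy}{x\,\overline{\Pi}^+(x)}=0$; (2) $\displaystyle\frac{\sup_{0<s\le t}\Delta X_s^-}{\sum_{0<s\le t}\Delta X_s^+}\to0$ if and only if $\displaystyle\lim_{x\downarrow0}\frac{x\,\overline{\Pi}^-(x)}{\int_0^x\overline{\Pi}^+(y)\,dy}=0$; (3) $\displaystyle\frac{\sum_{0<s\le t}\Delta X_s^-}{\sum_{0<s\le t}\Delta X_s^+}\to0$ if and only if $\displaystyle\lim_{x\downarrow0}\frac{\int_0^x\overline{\Pi}^-(y)\,dy}{\int_0^x\overline{\Pi}^+(y)\,dy}=0$; (4) $\displaystyle\frac{\sup_{0<s\le t}\Delta X_s^-}{\sup_{0<s\le t}\Delta X_s^+}\to0$ if and only if $\displaystyle\lim_{x\downarrow0}\frac{\overline{\Pi}^-(\varepsilon x)}{\overline{\Pi}^+(x)}=0$ for all $\varepsilon>0$.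
   Context: $\Pi$ is a Borel measure on $\mathbb R\setminus\{0\}$ with $\int(x^2\wedge1)\Pi(dx)<\infty$. For $x>0$, $\overline{\Pi}^+(x)=\Pi\{(x,\infty)\}$ and $\overline{\Pi}^-(x)=\Pi\{(-\infty,-x)\}$. $\Delta X_t=X_t-X_{t-}$, $\Delta X_t^+=\max(\Delta X_t,0)$, $\Delta X_t^-=\max(-\Delta X_t,0)$. Finiteness a.s. of the sums is understood for $t>0$. *)

(* Defs.v *)
(* MathComp / MathComp-Analysis *)
From HB Require Import structures.
From mathcomp Require Import all_boot all_order all_algebra.
From mathcomp Require Import all_classical all_reals all_analysis.
Set Implicit Arguments.
Unset Strict Implicit.
Unset Printing Implicit Defensive.
Import Order.TTheory GRing.Theory Num.Theory.
Import numFieldNormedType.Exports.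
Local Open Scope classical_set_scope.
Local Open Scope ring_scope.

Section Process.
Context (d : measure_display) (T : measurableType d) (R : realType).
Variable P : probability T R.

(* The product rule for the full family gives it for every subfamily, since
   some of the B i may be setT. *)
Definition mutually_independent (I : finType) (Y : I -> T -> R) : Prop :=
  forall B : I -> set (measurableTypeR R), (forall i, measurable (B i)) ->
    P (\bigcap_i (Y i @^-1` B i)) = (\prod_i P (Y i @^-1` B i))%E.

Definition cadlag (x : R -> R) : Prop :=
  (forall t : R, 0 <= t -> x u @[u --> t^'+] --> x t) /\
  (forall t : R, 0 < t -> cvg (x u @[u --> t^'-])).

(* Processes are indexed by R, but only the values at times t >= 0 matter. *)
Record levy_process (X : R -> {RV P >-> R}) : Prop := LevyProcess {
  levy_start : {ae P, forall w, X 0 w = 0} ;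
  levy_cadlag : forall w, cadlag (fun t => X t w) ;
  levy_independent : forall (n : nat) (t : nat -> R), 0 <= t 0%N ->
    (forall i, (i < n)%N -> t i <= t i.+1) ->
    mutually_independent (fun (i : 'I_n) w => X (t i.+1) w - X (t i) w) ;
  levy_stationary : forall (s t : R), 0 <= s -> 0 <= t ->
    forall B : set (measurableTypeR R), measurable B ->
    P [set w | B (X (s + t) w - X s w)] = P [set w | B (X t w)] }.

(* Only meaningful for t > 0. *)
Definition jump (X : R -> T -> R) (t : R) (w : T) : R :=
  X t w - lim (X u w @[u --> t^'-]).

Definition jump_pos (X : R -> T -> R) (t : R) (w : T) : R :=
  Num.max (jump X t w) 0.

Definition jump_neg (X : R -> T -> R) (t : R) (w : T) : R :=
  Num.max (- jump X t w) 0.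

(* Sums and suprema over 0 < s <= t are taken in [0, +oo]; the sum of an
   uncountable nonnegative family is the supremum of its finite subsums. *)
Definition sum_upto (J : R -> T -> R) (t : R) (w : T) : \bar R :=
  \esum_(s in `]0, t]) (J s w)%:E.

Definition sup_upto (J : R -> T -> R) (t : R) (w : T) : \bar R :=
  ereal_sup [set (J s w)%:E | s in `]0, t]].

(* A measure on R \ {0} is a measure on R that does not charge 0. *)
Definition levy_integrable (Pi : {measure set (measurableTypeR R) -> \bar R}) :
    Prop :=
  Pi [set 0] = 0%E /\
  (\int[Pi]_x (Num.min (x ^+ 2) 1)%:E < +oo)%E.

(* The measure of B is the expected number of jumps with size in B per unit
   of time. *)
Definition levy_measure_of (X : R -> T -> R)
    (Pi : {measure set (measurableTypeR R) -> \bar R}) : Prop :=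
  levy_integrable Pi /\
  forall B : set (measurableTypeR R), measurable B -> ~ B 0 ->
    Pi B = (\int[P]_w counting [set s : R | (0 < s <= 1)%R /\ B (jump X s w)])%E.

Definition cvg_in_probability_0 (Y : R -> T -> \bar R) : Prop :=
  forall e : R, 0 < e ->
    P [set w | (e%:E < `|Y t w|)%E] @[t --> 0^'+] --> 0%E.

End Process.

Section Tails.
Context (R : realType).
Variable Pi : {measure set (measurableTypeR R) -> \bar R}.

Definition tail_pos (x : R) : \bar R := Pi `]x, +oo[%classic.

Definition tail_neg (x : R) : \bar R := Pi `]-oo, (- x)[%classic.

End Tails.

Definition int_tail (R : realType) (tail : R -> \bar R) (x : R) : \bar R :=
  (\int[lebesgue_measure]_(y in `]0%R, x]) tail y)%E.

(* Main.v *)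
(* For a continuous f >= 0 vanishing near 0 and a cadlag path, the sums of f over
   the increments along equidistant grids converge to S_f(t), the sum of f over
   the jumps up to t.  Increments over a grid are i.i.d., so E exp (- S_f(t)) is
   multiplicative in t; comparing 1 - exp (- S_f(t)) with the sum of
   1 - exp (- f) over the jumps gives Campbell's formula
     E exp (- S_f(t)) = exp (- t r(f)),
   r(f) being the expectation of the sum of 1 - exp (- f) over the jumps up to
   time 1.  Increasing limits of such f give, for Y(t) the sum or the supremum of
   the jumps of one sign and M_x = exp (- Y(t) / x) or 1_(Y(t) <= x) respectively,
     E M_x = exp (- t psi(x)),
   and the independence of the positive and the negative jumps,
     E (M+_x M-_y) = exp (- t (psi+(x) + psi-(y))).
   Up to constants psi(x) is the average of the tail over ]0, x] for sums and the
   tail at x for suprema, so all four criteria read: for every e > 0,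
   psi-(e x) / psi+(x) -> 0.
   If this holds, choose y with t psi+(2 y) <= lambda < t psi+(y): then Y+ <= y has
   probability O(exp (- lambda)) and Y- > e y has probability O(t psi-(e y)) = o(1).
   Conversely, for t = 1 / psi+(x), the mean of M+_x (1 - M-_(e x)) is
   exp (- 1) (1 - exp (- psi-(e x) / psi+(x))), and it is at most
   P(Y- > delta Y+) + delta / e, since u exp (1 - u) <= 1. *)
Require Import Defs.
From HB Require Import structures.
From mathcomp Require Import all_boot all_order all_algebra.
From mathcomp Require Import all_classical all_reals all_analysis.
From mathcomp Require Import measurable_realfun.
From mathcomp Require Import ring lra.
Set Implicit Arguments.
Unset Strict Implicit.
Unset Printing Implicit Defensive.
Import Order.TTheory GRing.Theory Num.Theory.
Import numFieldNormedType.Exports.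
Local Open Scope classical_set_scope.
Local Open Scope ring_scope.

(** * Jumps of cadlag paths *)

(** Poisson random measures and the Lévy-Ito decomposition are avoided: the law of the jumps enters
    only through Laplace transforms of jump sums. The obstacle is that jump times are random, so
    neither measurability nor independence can be read off the definition of a jump sum; both come
    through grids. This is why test functions are continuous (the increment around a jump converges
    to it) and vanish near 0 (a path has finitely many jumps above each level, and cells of a fine
    grid away from them contribute nothing). Independence of the two signs amounts to additivity of
    1 - exp (- f) over functions with disjoint supports. Sums and suprema share one proof, with a
    boolean telling them apart, because the exponential and the indicator obey the same bounds up to
    a factor exp 1. Exponents and tails are compared through step functions with dyadic thresholds.
    The e of the criterion disappears as soon as one side is a sum: x psi(x) is then comparable with
    an increasing integral, so psi(e x) <= (C / e) psi(x) for e <= 1. For two suprema no such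
    regularity is available and e stays. *)

Section CadlagPaths.
Context {R : realType}.
Variable x : R -> R.
Hypothesis cx : cadlag x.

Definition path_jump (t : R) : R := x t - lim (x u @[u --> t^'-]).

(** Exceptional points are looked for in ]u, v] because the increment from u to v sees a jump at v
    but not one at u. *)
Definition almost_constant (e a b : R) (C : seq R) :=
  forall u v, a <= u -> u <= v -> v <= b ->
    (forall c, c \in C -> ~~ (u < c <= v)) -> `|x v - x u| <= e.

(** Right continuity at [c] controls the path only before [c + r], so the end point [c + r] has to
    be declared exceptional. *)
Lemma right_almost_constant e c : 0 < e -> 0 <= c ->
  exists2 r, 0 < r & almost_constant e c (c + r) [:: c + r].
Proof.
move=> e0 c0; have [cr _] := cx.
have /cvgrPdist_lt /(_ (e / 2)) := cr c c0.
rewrite divr_gt0// => /(_ isT) [r /= r0 H].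
have {}H u : c <= u -> u < c + r -> `|x c - x u| < e / 2.
  rewrite le_eqVlt => /predU1P[<- _|cu ucr]; first by rewrite subrr normr0 divr_gt0.
  apply: H => //=; rewrite distrC ger0_norm; lra.
exists r => // u v cu uv vcr /(_ (c + r)); rewrite mem_head => /(_ isT).
have [ucr|ucr _] := ltP u (c + r); last first.
  have -> : u = v by lra.
  by rewrite subrr normr0 ltW.
rewrite /= -ltNge => vr.
have -> : x v - x u = (x c - x u) - (x c - x v) by ring.
rewrite (le_trans (ler_normB _ _))//.
have := H _ cu ucr; have := H v (le_trans cu uv) vr; lra.
Qed.

(** The left limit makes the path nearly constant just before [c]; only the jump at [c] itself is an
    exception. *)
Lemma left_almost_constant e c : 0 < e -> 0 < c ->
  exists2 r, 0 < r & forall a, c - r < a -> almost_constant e a c [:: c].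
Proof.
move=> e0 c0; have [_ /(_ c c0)] := cx.
move=> /cvgrPdist_lt /(_ (e / 2)).
rewrite divr_gt0// => /(_ isT) [r /= r0 H].
set l := lim _ in H.
have {}H u : c - r < u -> u < c -> `|l - x u| < e / 2.
  by move=> cu uc; apply: H => //=; rewrite ger0_norm; lra.
exists r => // a ca u v au uv vcr /(_ c); rewrite mem_head => /(_ isT).
have [ucr|ucr _] := ltP u c; last first.
  have -> : u = v by lra.
  by rewrite subrr normr0 ltW.
rewrite /= -ltNge => vr.
have -> : x v - x u = (l - x u) - (l - x v) by ring.
rewrite (le_trans (ler_normB _ _))//.
have := H u (lt_le_trans ca au) ucr.
have := H v (lt_le_trans ca (le_trans au uv)) vr; lra.
Qed.

(** Once [b] is exceptional, an admissible ]u, v] lies on one side of it. *)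
Lemma almost_constant_cat e a b c C D :
  almost_constant e a b C -> almost_constant e b c D ->
  almost_constant e a c (b :: C ++ D).
Proof.
move=> H1 H2 u v au uv vc H.
have /[!mem_head]/(_ isT) := H b.
rewrite negb_and -leNgt -ltNge => /orP[bu|vb].
- by apply: H2 => // d dD; apply: H; rewrite inE mem_cat dD !orbT.
- by apply: H1 => //; [exact: ltW|move=> d dC; apply: H; rewrite inE mem_cat dC !orbT].
Qed.

(* Real induction on the right endpoint. *)
Lemma cadlag_almost_constant e a b : 0 < e -> 0 <= a -> a <= b ->
  exists C, almost_constant e a b C.
Proof.
move=> e0 a0 ab.
pose S := [set c | a <= c <= b /\ exists C, almost_constant e a c C].
have Sa : S a.
  split; first by rewrite lexx.
  exists [::] => u v au uv va _; have -> : u = v by lra.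
  by rewrite subrr normr0 ltW.
have Sb : ubound S b by move=> c [/andP[]].
have hS : has_sup S by split; [exists a|exists b].
have Sle c : S c -> c <= sup S by move=> Sc; apply: ub_le_sup => //; exists b.
have as_ : a <= sup S by exact: Sle.
have sb : sup S <= b by apply: ge_sup => //; exists a.
(* The left limit at [sup S] shows that the supremum is attained. *)
have Ss : S (sup S).
  split; first by rewrite as_.
  move: as_; rewrite le_eqVlt => /predU1P[<-|as_]; first by case: Sa.
  have s0 : 0 < sup S by lra.
  have [r r0 H] := left_almost_constant e0 s0.
  have [c [cab [C HC]] cs] := sup_adherent r0 hS.
  by eexists; apply: almost_constant_cat HC (H _ cs).
case: Ss => _ [C HC].
move: sb; rewrite le_eqVlt => /predU1P[sE|sb]; first by exists C; rewrite -sE.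
(* If [sup S < b], right continuity goes past [sup S], a contradiction. *)
have [r r0 H] := right_almost_constant e0 (le_trans a0 as_).
pose c := Num.min (sup S + r) b.
have H' : exists D, almost_constant e a c D.
  eexists; apply: almost_constant_cat HC _.
  rewrite /c; case: (leP (sup S + r) b) => [_|br]; first exact: H.
  move=> u v su uv vb Hc; apply: H => //; lra.
have /Sle : S c.
  split => //; rewrite /c; case: (leP (sup S + r) b); lra.
rewrite /c; case: (leP (sup S + r) b); lra.
Qed.

(** The bound holds for x t - x u as soon as u < t lies beyond all exceptional points below t, and
    it survives the left limit. *)
Lemma path_jump_le e a b C t : almost_constant e a b C -> 0 <= a ->
  a < t <= b -> t \notin C -> `|path_jump t| <= e.
Proof.
move=> H a0 /andP[at_ tb] tC.
have [_ /(_ t) cl] := cx.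
have {}cl := cl (le_lt_trans a0 at_).
have cj : `|x t - x u| @[u --> t^'-] --> `|path_jump t|.
  by apply: cvg_norm; apply: cvgB => //; exact: cvg_cst.
apply: (closed_cvg (fun y => y <= e) (@closed_le R e) _ _ cj).
have [m [mt Hm]] : exists m, m < t /\ forall c, c \in C -> c < t -> c <= m.
  elim: C tC {H} => [|c C IH]; first by exists (t - 1); split => //; lra.
  rewrite inE negb_or => /andP[tc /IH[m [mt Hm]]].
  have [ct|tc'] := ltP c t.
    exists (Num.max m c); split; first by rewrite gt_max mt ct.
    by move=> d; rewrite inE le_max => /predU1P[-> _|/Hm/[apply] ->//]; rewrite lexx orbT.
  exists m; split => // d; rewrite inE => /predU1P[->|/Hm//].
  by rewrite ltNge tc'.
near=> u.
have ut : u < t by near: u; exact: nbhs_left_lt.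
have mu : m < u by near: u; exact: nbhs_left_gt.
have au : a < u by near: u; exact: nbhs_left_gt.
apply: (H u t (ltW au) (ltW ut) tb).
move=> c cC; apply/negP => /andP[uc ct].
have : c < t by rewrite lt_neqAle ct andbT; apply: contraNneq tC => <-.
by move/(Hm _ cC); rewrite leNgt (lt_trans mu uc).
Unshelve. all: by end_near. Qed.

End CadlagPaths.

Lemma near_seq_all (I : Type) (F : set_system I) (FF : Filter F) (T : eqType)
    (s : seq T) (Q : T -> I -> Prop) :
  (forall c, c \in s -> \forall i \near F, Q c i) ->
  \forall i \near F, forall c, c \in s -> Q c i.
Proof.
elim: s => [|c s IH] H; first by near=> i.
have Hc := H c (mem_head _ _).
have Hs : \forall i \near F, forall d, d \in s -> Q d i.
  by apply: IH => d ds; apply: H; rewrite inE ds orbT.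
near=> i => d; rewrite inE => /predU1P[->|ds].
- by near: i.
- by move: d ds; near: i.
Unshelve. all: by end_near. Qed.

Section Grid.
Context {R : realType}.
Implicit Types a h c : R.

Definition grid a h (n i : nat) : R := a + i%:R * (h / n.+1%:R).

Lemma grid0 a h n : grid a h n 0 = a.
Proof. by rewrite /grid mul0r addr0. Qed.

Lemma grid_max a h n : grid a h n n.+1 = a + h.
Proof. by rewrite /grid; congr (_ + _); field; rewrite addrC natr1 pnatr_eq0. Qed.

Lemma gridS a h n i : grid a h n i.+1 = grid a h n i + h / n.+1%:R.
Proof. by rewrite /grid -natr1; ring. Qed.

Lemma le_grid a h n i j : 0 <= h -> (i <= j)%N -> grid a h n i <= grid a h n j.
Proof.
by move=> h0 ij; rewrite lerD2l ler_wpM2r ?ler_nat// divr_ge0.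
Qed.

Lemma grid_cell a h n c : a < c <= a + h ->
  exists i : 'I_n.+1, grid a h n i < c <= grid a h n i.+1.
Proof.
move=> /andP[ac cah].
have ex : exists i, c <= grid a h n i.+1 by exists n; rewrite grid_max.
have [i ci mini] := ex_minnP ex.
have ilt : (i < n.+1)%N by rewrite ltnS mini// grid_max.
exists (Ordinal ilt) => /=; rewrite ci andbT.
case: i ci mini {ilt} => [|i] ci mini; first by rewrite grid0.
by rewrite ltNge; apply/negP => /mini; rewrite ltnn.
Qed.

Lemma grid_cell_inj a h n c (i j : nat) : 0 <= h ->
  grid a h n i < c <= grid a h n i.+1 ->
  grid a h n j < c <= grid a h n j.+1 -> i = j.
Proof.
move=> h0 /andP[ic ci] /andP[jc cj]; apply/eqP; rewrite eqn_leq.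
apply/andP; split; rewrite leqNgt; apply/negP => lt.
- by have := le_grid a n h0 lt; lra.
- by have := le_grid a n h0 lt; lra.
Qed.

(** Also serves below as the Archimedean property, to choose harmonic or dyadic scales. *)
Lemma near_mesh h e : 0 < e -> \forall n \near \oo, h / n.+1%:R < e.
Proof.
move=> e0; near=> n.
have n0 : 0 < n.+1%:R :> R by rewrite ltr0n.
rewrite ltr_pdivrMr// -ltr_pdivrMl// mulrC.
apply: (@lt_le_trans _ _ n%:R); last by rewrite ler_nat.
by near: n; exact: nbhs_infty_gtr.
Unshelve. all: by end_near. Qed.

End Grid.

(** * Sums over jumps as limits of sums over grid increments *)

Section GridJumps.
Context {R : realType}.
Variables (x : R -> R) (f : R -> R) (delta a h : R) (C : seq R).
Hypothesis cx : cadlag x.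
Hypothesis cf : continuous f.
Hypothesis f0 : forall y, `|y| <= delta -> f y = 0.
Hypotheses (a0 : 0 <= a) (h0 : 0 < h).
Hypothesis HC : almost_constant x delta a (a + h) C.

Let D := undup [seq c <- C | a < c <= a + h].

Let in_D c : (c \in D) = (c \in C) && (a < c <= a + h).
Proof. by rewrite mem_undup mem_filter andbC. Qed.

Let incr n i := x (grid a h n i.+1) - x (grid a h n i).

(** The left end of the cell stays strictly below [c], where the path tends to its left limit; the
    right end is at least [c], where right continuity applies. *)
Lemma near_incr (c e : R) : 0 < e -> a < c <= a + h ->
  \forall n \near \oo, forall i, grid a h n i < c <= grid a h n i.+1 ->
    `|f (incr n i) - f (path_jump x c)| < e.
Proof.
move=> e0 /andP[ac cah]; have [cr cl] := cx.
have c0 : 0 < c by exact: le_lt_trans ac.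
have : f y @[y --> path_jump x c] --> f (path_jump x c) by exact: cf.
move=> /cvgrPdist_lt /(_ e e0) /= /nbhs_normP[eta /= eta0 Heta].
have eta20 : 0 < eta / 2 by rewrite divr_gt0.
have /cvgrPdist_lt /(_ _ eta20) [r1 /= r10 H1] := cr c (ltW c0).
have /cvgrPdist_lt /(_ _ eta20) [r2 /= r20 H2] := cl c c0.
near=> n => i /andP[ic ci].
have m1 : h / n.+1%:R < r1 by near: n; exact: near_mesh.
have m2 : h / n.+1%:R < r2 by near: n; exact: near_mesh.
have gS := gridS a h n i.
set m := h / n.+1%:R in m1 m2 gS; clearbody m.
rewrite distrC; apply: Heta => /=.
have L : `|lim (x u @[u --> c^'-]) - x (grid a h n i)| < eta / 2.
  by apply: H2 => //=; rewrite ger0_norm; lra.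
have U : `|x c - x (grid a h n i.+1)| < eta / 2.
  move: ci; rewrite le_eqVlt => /predU1P[<-|ci]; first by rewrite subrr normr0.
  by apply: H1 => //=; rewrite ler0_norm; lra.
rewrite /path_jump /incr.
set l := lim _ in L *.
have -> : x c - l - (x (grid a h n i.+1) - x (grid a h n i)) =
  (x c - x (grid a h n i.+1)) - (l - x (grid a h n i)) by ring.
rewrite (le_lt_trans (ler_normB _ _))//; lra.
Unshelve. all: by end_near. Qed.

(** Ensures that a cell contains at most one point of [D]. *)
Lemma near_separated : \forall n \near \oo, forall c, c \in D ->
  forall c', c' \in D -> c != c' -> h / n.+1%:R < `|c - c'|.
Proof.
apply: near_seq_all => c _; apply: near_seq_all => c' _.
have [<-|cc'] := eqVneq c c'; first by near=> n.
have : 0 < `|c - c'| by rewrite normr_gt0 subr_eq0.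
by move/(near_mesh h); apply: filterS => n H _.
Unshelve. all: by end_near. Qed.

Lemma grid_sum_split : \forall n \near \oo,
  \sum_(i < n.+1) f (incr n i) =
  \sum_(c <- D) \sum_(i < n.+1 | grid a h n i < c <= grid a h n i.+1) f (incr n i).
Proof.
have := near_separated; apply: filterS => n sep.
rewrite [RHS](eq_bigr (fun c => \sum_(i < n.+1)
   (if grid a h n i < c <= grid a h n i.+1 then f (incr n i) else 0))); last first.
  by move=> c _; rewrite big_mkcond.
rewrite exchange_big /=; apply: eq_bigr => i _.
rewrite -big_mkcond /=.
have gi : a <= grid a h n i by rewrite -[leLHS](grid0 a h n) le_grid// ltW.
have gi1 : grid a h n i.+1 <= a + h by rewrite -(grid_max a h n) le_grid// ltW.
have [/hasP[c cD ic]|/hasPn noc] := boolP (has (fun c => grid a h n i < c <= grid a h n i.+1) D).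
  rewrite -big_filter.
  have -> : [seq c0 <- D | grid a h n i < c0 <= grid a h n i.+1] = [:: c].
    rewrite (@eq_in_filter _ _ (pred1 c)); last first.
      move=> c' c'D /=; apply/idP/eqP => [ic'|->//].
      apply/eqP; apply: contraT => cc'.
      have := sep _ c'D _ cD cc'.
      move: ic ic' => /andP[? ?] /andP[? ?]; have := gridS a h n i.
      set m := h / n.+1%:R; clearbody m.
      by case: (ger0P (c' - c)); intros; exfalso; lra.
    by rewrite filter_pred1_uniq ?undup_uniq.
  by rewrite big_seq1.
rewrite big_seq_cond big1 ?addr0; last first.
  by move=> c /andP[/noc /negbTE ->].
(* A cell that misses [D] has an increment of size at most [delta], where [f] vanishes. *)
rewrite f0//; apply: HC => //.
  by rewrite gridS lerDl divr_ge0// ltW.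
move=> c cC; apply/negP => icc.
suff /noc : c \in D by rewrite icc.
rewrite in_D cC /=; move: icc => /andP[? ?].
by apply/andP; split; lra.
Qed.

Lemma grid_sum_cvg : (\sum_(i < n.+1) f (incr n i)) @[n --> \oo] -->
  \sum_(c <- D) f (path_jump x c).
Proof.
have H : (\sum_(c <- D) \sum_(i < n.+1 | grid a h n i < c <= grid a h n i.+1) f (incr n i))
   @[n --> \oo] --> \sum_(c <- D) f (path_jump x c).
  rewrite [X in _ --> X]big_seq_cond.
  under eq_fun do rewrite big_seq_cond.
  apply: (cvg_big (@add_continuous R)) => c; rewrite in_D andbT => /andP[_ cah].
  apply/cvgrPdist_lt => e e0.
  have := near_incr e0 cah; apply: filterS => n Hn.
  have [i ic] := grid_cell n cah.
  have E : (fun j : 'I_n.+1 => grid a h n j < c <= grid a h n j.+1) =1 pred1 i.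
    move=> j /=; apply/idP/eqP => [jc|->//].
    by apply: val_inj; apply: grid_cell_inj jc ic; exact: ltW.
  rewrite (eq_bigl _ _ E) big_pred1_eq distrC; exact: Hn.
apply: cvg_trans H; apply: near_eq_cvg.
by have := grid_sum_split; apply: filterS => n ->.
Qed.

(** The uncountable sum reduces to [D] because every other jump has size at most [delta]. *)
Lemma esum_path_jump : (forall y, 0 <= f y) ->
  \esum_(u in `]a, a + h]) (f (path_jump x u))%:E =
  (\sum_(c <- D) f (path_jump x c))%:E.
Proof.
move=> fge0.
rewrite (esumID [set` D]); last by move=> *; rewrite lee_fin.
rewrite [X in (_ + X)%E]esum1 ?adde0; last first.
  move=> u /= [uah uD]; rewrite f0//.
  move: uah; rewrite in_itv /= => uah.
  apply: (path_jump_le cx HC) => //.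
  by apply/negP => uC; apply: uD; rewrite in_D uC.
have -> : `]a, a + h] `&` [set` D] = [set` D].
  by apply/setIidPr => c /=; rewrite in_D in_itv /= => /andP[].
rewrite esum_fset; [|exact: finite_seq|by move=> *; rewrite lee_fin].
by rewrite -fsbig_seq ?undup_uniq// sumEFin.
Qed.

End GridJumps.

Section GridEsum.
Context {R : realType}.
Variables (x : R -> R) (f : R -> R) (delta a h : R).
Hypothesis cx : cadlag x.
Hypothesis cf : continuous f.
Hypothesis fge0 : forall y, 0 <= f y.
Hypothesis f0 : forall y, `|y| <= delta -> f y = 0.
Hypotheses (delta0 : 0 < delta) (a0 : 0 <= a) (h0 : 0 < h).

Lemma grid_cvg_esum :
  (\sum_(i < n.+1) f (x (grid a h n i.+1) - x (grid a h n i)))%:E @[n --> \oo] -->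
  \esum_(u in `]a, a + h]) (f (path_jump x u))%:E.
Proof.
have aah : a <= a + h by rewrite lerDl ltW.
have [C HC] := cadlag_almost_constant cx delta0 a0 aah.
rewrite (esum_path_jump cx f0 a0 HC)//.
apply/fine_cvgP; split; first by near=> n.
exact: (grid_sum_cvg cx cf f0 a0 h0 HC).
Unshelve. all: by end_near. Qed.

Lemma esum_path_jump_fin :
  \esum_(u in `]a, a + h]) (f (path_jump x u))%:E \is a fin_num.
Proof.
have aah : a <= a + h by rewrite lerDl ltW.
have [C HC] := cadlag_almost_constant cx delta0 a0 aah.
by rewrite (esum_path_jump cx f0 a0 HC).
Qed.

End GridEsum.

(** * Expectations of products of independent variables *)

Section IntegralExtension.
Context d (T : measurableType d) (R : realType) (P : {measure set T -> \bar R}).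
Implicit Types (W : T -> R) (Y : T -> measurableTypeR R).
Local Open Scope ereal_scope.
Import HBNNSimple.

Lemma integral_comp_nnsfun W Y (h : {nnsfun (measurableTypeR R) >-> R}) :
  (forall w, 0 <= W w)%R -> measurable_fun setT W -> measurable_fun setT Y ->
  \int[P]_w ((W w)%:E * (h (Y w))%:E) =
  \sum_(r \in range h) r%:E * \int[P]_w ((W w)%:E * (\1_(h @^-1` [set r]) (Y w))%:E).
Proof.
move=> W0 mW mY.
have mI r : measurable_fun setT (fun w => (\1_(h @^-1` [set r]) (Y w) : R)).
  apply: (@measurableT_comp _ _ _ _ _ _ (\1_(h @^-1` [set r]) : _ -> R)) => //.
transitivity (\int[P]_w (\sum_(r \in range h)
    r%:E * ((W w)%:E * (\1_(h @^-1` [set r]) (Y w))%:E))).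
  apply: eq_integral => w _.
  rewrite [in LHS]fimfunE -fsumEFin// ge0_mule_fsumr; last first.
    by move=> r; rewrite EFinM nnfun_muleindic_ge0.
  by apply: eq_fsbigr => r _; rewrite EFinM muleCA.
rewrite ge0_integral_fsum//.
- apply: eq_fsbigr => r; rewrite inE => -[y _ <-].
  rewrite ge0_integralZl_EFin//.
  + by move=> w _; rewrite mule_ge0// lee_fin.
  + by apply: emeasurable_funM; exact/measurable_EFinP.
- move=> r; apply: emeasurable_funM => //.
  by apply: emeasurable_funM; exact/measurable_EFinP.
- move=> r w _; rewrite muleCA mule_ge0 ?lee_fin//.
  exact: nnfun_muleindic_ge0.
Qed.

(** From indicators to simple functions to monotone limits. The weights [W1], [W2] carry the other
    factors of a product, so that independence can be extended one factor at a time. *)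
Lemma ge0_integral_comp_ext (c : R) W1 W2 Y1 Y2 (g : measurableTypeR R -> R) :
  (0 <= c)%R ->
  (forall w, 0 <= W1 w)%R -> measurable_fun setT W1 -> measurable_fun setT Y1 ->
  (forall w, 0 <= W2 w)%R -> measurable_fun setT W2 -> measurable_fun setT Y2 ->
  (forall B, measurable B -> \int[P]_w ((W1 w)%:E * (\1_B (Y1 w))%:E) =
    c%:E * \int[P]_w ((W2 w)%:E * (\1_B (Y2 w))%:E)) ->
  measurable_fun setT g -> (forall y, 0 <= g y)%R ->
  \int[P]_w (W1 w * g (Y1 w))%:E = c%:E * \int[P]_w (W2 w * g (Y2 w))%:E.
Proof.
move=> c0 W10 mW1 mY1 W20 mW2 mY2 H mg g0.
have mgE : measurable_fun setT (EFin \o g) by exact/measurable_EFinP.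
pose h n := nnsfun_approx measurableT mgE n.
have lim_h (W : T -> R) (Y : T -> measurableTypeR R) : (forall w, 0 <= W w)%R ->
    measurable_fun setT W -> measurable_fun setT Y ->
    \int[P]_w ((W w)%:E * (h n (Y w))%:E) @[n --> \oo] -->
    \int[P]_w (W w * g (Y w))%:E.
  move=> W0 mW mY.
  have hcvg w : (W w)%:E * (h n (Y w))%:E @[n --> \oo] --> (W w * g (Y w))%:E.
    rewrite EFinM; apply: cvgeZl => //.
    by apply: (@cvg_nnsfun_approx _ _ _ _ measurableT _ mgE) => //= y _; rewrite lee_fin.
  have := @cvg_monotone_convergence _ _ _ P setT measurableT
    (fun n w => (W w)%:E * (h n (Y w))%:E).
  rewrite (_ : (fun x => limn _) = (fun w => (W w * g (Y w))%:E)); last first.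
    by apply/funext => w; apply/cvg_lim => //.
  apply.
  - move=> n; apply: emeasurable_funM; first exact/measurable_EFinP.
    by apply/measurable_EFinP; apply: measurableT_comp.
  - by move=> n w _; rewrite mule_ge0// lee_fin.
  - move=> w _ m n mn; rewrite lee_pmul// ?lee_fin//.
    exact/lefP/nd_nnsfun_approx.
apply/esym; apply: cvg_unique (lim_h _ _ W10 mW1 mY1) => //.
rewrite (_ : (fun n => _) = (fun n => c%:E * \int[P]_w ((W2 w)%:E * (h n (Y2 w))%:E))).
  by apply: cvgeZl => //; exact: lim_h.
apply/funext => n.
rewrite !integral_comp_nnsfun// ge0_mule_fsumr; last first.
  (* For r < 0 the level set is empty, [h] being nonnegative. *)
  move=> r; have [r0|r0] := leP 0%R r.
    by rewrite mule_ge0// integral_ge0// => w _; rewrite mule_ge0// lee_fin.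
  rewrite integral0_eq ?mule0// => w _.
  rewrite indicE memNset ?mule0//= => hr.
  by move: r0; rewrite -hr ltNge => /negP; apply; exact: fun_ge0.
apply: eq_fsbigr => r _; rewrite H; last exact: measurable_sfunP.
by rewrite muleCA.
Qed.
End IntegralExtension.

Section IndependentProducts.
Context d (T : measurableType d) (R : realType) (P : probability T R).
Local Open Scope ereal_scope.

Lemma integral_unit_fin_num (h : T -> R) : measurable_fun setT h ->
  (forall w, 0 <= h w <= 1)%R -> \int[P]_w (h w)%:E \is a fin_num.
Proof.
move=> mh h01; rewrite ge0_fin_numE; last first.
  by apply: integral_ge0 => w _; rewrite lee_fin; case/andP: (h01 w).
apply: (@le_lt_trans _ _ (\int[P]_w (cst 1 w))).
  apply: ge0_le_integral => //.
  - by move=> w _; rewrite lee_fin; case/andP: (h01 w).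
  - exact/measurable_EFinP.
  - by move=> w _; rewrite lee_fin; case/andP: (h01 w).
by rewrite integral_cst// mul1e (le_lt_trans (probability_le1 _ _))// ltry.
Qed.

Variables (I : finType) (Y : I -> T -> R).
Hypothesis mY : forall i, measurable_fun setT (Y i : T -> measurableTypeR R).
Hypothesis indepY : mutually_independent P Y.

Let product_rule (G : I -> measurableTypeR R -> R) :=
  \int[P]_w (\prod_i G i (Y i w))%:E = \prod_i \int[P]_w (G i (Y i w))%:E.

Let product_rule_indic (B : I -> set (measurableTypeR R)) :
  (forall i, measurable (B i)) -> product_rule (fun i => \1_(B i)).
Proof.
move=> mB; rewrite /product_rule.
have mYB i : measurable (Y i @^-1` B i) by rewrite -[X in measurable X]setTI; exact: mY.
transitivity (\int[P]_w (\1_(\bigcap_i (Y i @^-1` B i)) w)%:E).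
  apply: eq_integral => w _; congr EFin; rewrite !indicE.
  have [/[!inE] wB|/negP wB] := boolP (w \in \bigcap_i (Y i @^-1` B i)).
    by rewrite big1// => i _; rewrite indicE mem_set//; exact: wB.
  have /existsNP[i Bi] : ~ forall i, B i (Y i w).
    by move=> H; apply: wB; rewrite inE => i _; exact: H.
  by rewrite (bigD1 i)//= indicE memNset// mul0r.
rewrite integral_indic ?setIT//; last by apply: fin_bigcap_measurable => //; exact: finite_finset.
transitivity (\prod_i P (Y i @^-1` B i)); first exact: indepY.
apply: eq_bigr => i _.
by rewrite -[Y i @^-1` B i]setIT -integral_indic ?setIT//.
Qed.

Lemma integral_prod_independent (G : I -> measurableTypeR R -> R) :
  (forall i, measurable_fun setT (G i)) -> (forall i y, 0 <= G i y <= 1)%R ->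
  \int[P]_w (\prod_i G i (Y i w))%:E = \prod_i \int[P]_w (G i (Y i w))%:E.
Proof.
have mGY (H : measurableTypeR R -> R) i : measurable_fun setT H ->
  measurable_fun setT (fun w => H (Y i w)).
  by move=> mH; exact: (@measurableT_comp _ _ _ _ _ _ H _ (Y i) mH (mY i)).
(* Induction on a list [s] outside which all factors are indicators; the base case is the product
   rule for events. *)
suff claim (s : seq I) (H : I -> measurableTypeR R -> R) :
    (forall i, measurable_fun setT (H i)) -> (forall i y, 0 <= H i y <= 1)%R ->
    (forall i, i \notin s -> exists2 B, measurable B & H i = \1_B) -> product_rule H.
  by move=> mG G01; apply: (claim (enum I)) => // i; rewrite mem_enum.
elim: s H => [|a s IH] H mH H01 Hs.
  have /choice[B HB] : forall i, exists B : set (measurableTypeR R), measurable B /\ H i = \1_B.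
    by move=> i; have [B] := Hs i isT; exists B.
  rewrite (_ : H = fun i => \1_(B i)); last by apply/funext => i; case: (HB i).
  by apply: product_rule_indic => i; case: (HB i).
pose W w := (\prod_(i | i != a) H i (Y i w))%R.
pose c := (\prod_(i | i != a) fine (\int[P]_w (H i (Y i w))%:E))%R.
have fE i : (fine (\int[P]_w (H i (Y i w))%:E))%:E = \int[P]_w (H i (Y i w))%:E.
  by rewrite fineK// integral_unit_fin_num//; exact: mGY.
have cE : c%:E = \prod_(i | i != a) \int[P]_w (H i (Y i w))%:E.
  by rewrite /c -prodEFin; apply: eq_bigr => i _.
have c0 : (0 <= c)%R.
  apply: prodr_ge0 => i _; apply: fine_ge0; apply: integral_ge0 => w _.
  by rewrite lee_fin; case/andP: (H01 i (Y i w)).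
have W0 w : (0 <= W w)%R by apply: prodr_ge0 => i _; case/andP: (H01 i (Y i w)).
have mW : measurable_fun setT W.
  rewrite /W; under eq_fun do rewrite -big_filter.
  by apply: measurable_prod => i _; exact: mGY.
rewrite /product_rule.
transitivity (\int[P]_w (W w * H a (Y a w))%:E).
  by apply: eq_integral => w _; rewrite (bigD1 a)//= mulrC.
rewrite (bigD1 a)//= muleC -cE.
(* Only the factor [a] varies: the others form the weight [W], and [IH] is used with an indicator in
   place of [H a]. *)
rewrite (@ge0_integral_comp_ext _ _ _ P c W (cst 1%R) (Y a) (Y a) (H a))//.
- by congr (_ * _); apply: eq_integral => w _; rewrite /= mul1r.
- move=> B mB.
  pose H' i := if i == a then \1_B else H i : measurableTypeR R -> R.
  have H'a : H' a = \1_B by rewrite /H' eqxx.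
  have H'N i : i != a -> H' i = H i by rewrite /H' => /negbTE ->.
  have := IH H'; rewrite /product_rule [X in _ = X](bigD1 a)//= H'a.
  rewrite [X in _ = _ * X](eq_bigr (fun i => \int[P]_w (H i (Y i w))%:E)); last first.
    by move=> i ia; rewrite H'N.
  rewrite -cE muleC => IHB.
  under [X in _ = _ * X]eq_integral do rewrite mul1e.
  rewrite -IHB.
  + apply: eq_integral => w _; rewrite (bigD1 a)//= H'a mulrC EFinM.
    by congr (_%:E * _); apply: eq_bigr => i ia; rewrite H'N.
  + by move=> i; rewrite /H'; case: ifP => // _; exact: measurable_indic.
  + move=> i y; rewrite /H'; case: ifP => // _.
    by rewrite indicE; case: (_ \in _); rewrite /= ?lexx ?ler01.
  + move=> i /=; rewrite /H'; case: ifPn => [_ _|ia ias]; first by exists B.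
    by apply: Hs; rewrite inE negb_or ia.
- by move=> y; case/andP: (H01 a y).
Qed.

End IndependentProducts.

(** * Expectations of variables with values in [0, 1] *)

Section UnitExpectation.
Context d (T : measurableType d) (R : realType) (P : probability T R).

Definition mean (h : T -> R) : R := fine (\int[P]_w (h w)%:E).

Lemma meanE (h : T -> R) : measurable_fun setT h ->
  (forall w, 0 <= h w <= 1) -> (\int[P]_w (h w)%:E = (mean h)%:E)%E.
Proof. by move=> mh h01; rewrite /mean fineK// integral_unit_fin_num. Qed.

Lemma integral_probability_cst (r : R) : (\int[P]_w r%:E = r%:E)%E.
Proof.
rewrite integral_cst// -[RHS]mule1; congr (_ * _)%E; exact: probability_setT.
Qed.

Lemma mean_ge0 (h : T -> R) : (forall w, 0 <= h w) -> 0 <= mean h.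
Proof.
by move=> h0; apply: fine_ge0; apply: integral_ge0 => w _; rewrite lee_fin.
Qed.

Lemma le_mean (h k : T -> R) : measurable_fun setT h -> measurable_fun setT k ->
  (forall w, 0 <= h w <= 1) -> (forall w, 0 <= k w <= 1) ->
  (forall w, h w <= k w) -> mean h <= mean k.
Proof.
move=> mh mk h01 k01 hk; rewrite -lee_fin -!meanE//.
apply: ge0_le_integral => //.
- by move=> w _; rewrite lee_fin; case/andP: (h01 w).
- exact/measurable_EFinP.
- exact/measurable_EFinP.
- by move=> w _; rewrite lee_fin.
Qed.

Lemma mean_cst (r : R) : mean (fun=> r) = r.
Proof. by rewrite /mean integral_probability_cst. Qed.

Lemma mean_unit (h : T -> R) : measurable_fun setT h ->
  (forall w, 0 <= h w <= 1) -> 0 <= mean h <= 1.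
Proof.
move=> mh h01; apply/andP; split.
  by apply: mean_ge0 => w; case/andP: (h01 w).
rewrite -[leRHS]mean_cst; apply: le_mean => // w; first by rewrite ler01 lexx.
by case/andP: (h01 w).
Qed.

Lemma mean_gt0 (h : T -> R) : measurable_fun setT h ->
  (forall w, 0 <= h w <= 1) -> ~ {ae P, forall w, h w = 0} -> 0 < mean h.
Proof.
move=> mh h01 nae; rewrite lt_def mean_ge0 ?andbT; last by move=> w; case/andP: (h01 w).
apply/eqP => m0; apply: nae.
have : (\int[P]_w `|(h w)%:E| = 0)%E.
  rewrite -[RHS]/(0%:E) -m0 -meanE//; apply: eq_integral => w _.
  by rewrite gee0_abs// lee_fin; case/andP: (h01 w).
move/ae_eq_integral_abs => H.
have {H} := H measurableT ltac:(exact/measurable_EFinP).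
by apply: filterS => w /(_ I) [].
Qed.

(** The whole space is not a null set; with [mean_gt0] this makes means of exponentials positive. *)
Lemma not_ae_false (Q : T -> Prop) : (forall w, ~ Q w) -> ~ {ae P, forall w, Q w}.
Proof.
move=> nQ [N [mN N0 subN]].
have : N = setT by apply/seteqP; split => // w _; apply: subN; exact: nQ.
by move=> NT; move: N0; rewrite NT probability_setT => /eqP; rewrite onee_eq0.
Qed.

Lemma cvg_mean (h_ : nat -> T -> R) (h : T -> R) :
  (forall n, measurable_fun setT (h_ n)) -> (forall n w, 0 <= h_ n w <= 1) ->
  (forall w, h_ n w @[n --> \oo] --> h w) ->
  mean (h_ n) @[n --> \oo] --> mean h.
Proof.
move=> mh h01 hcvg.
have mh' : measurable_fun setT h.
  by apply: (measurable_fun_cvg mh) => w _; exact: hcvg.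
have h'01 w : 0 <= h w <= 1.
  have cl : closed (fun y : R => 0 <= y <= 1).
    rewrite (_ : (fun y : R => _) = [set` `[0, 1]]); first exact: itv_closed.
    by apply/seteqP; split => y /=; rewrite in_itv.
  by apply: (closed_cvg _ cl _ _ (hcvg w)); near=> n; exact: h01.
have : (\int[P]_w (h_ n w)%:E)%E @[n --> \oo] --> (\int[P]_w (h w)%:E)%E.
  apply: (@dominated_cvg _ _ _ _ _ measurableT _ _ (cst 1%E)) => //.
  - by move=> n; exact/measurable_EFinP.
  - move=> w _; apply/fine_cvgP; split; first by near=> n.
    exact: hcvg.
  - apply/integrableP; split => //.
    under eq_integral do rewrite /= normr1.
    by rewrite integral_probability_cst ltry.
  - by move=> n w _; rewrite lee_fin ger0_norm; case/andP: (h01 n w).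
rewrite (meanE mh' h'01) => /fine_cvgP[_].
by under eq_fun do rewrite /= (meanE (mh _) (h01 _)).
Unshelve. all: by end_near. Qed.

End UnitExpectation.

(** * Sums of test functions over the jumps of a Lévy process *)

Section LevyJumpSums.
Context d (T : measurableType d) (R : realType) (P : probability T R).
Variable X : R -> {RV P >-> R}.
Hypothesis LX : levy_process X.

Definition jump_test (f : R -> R) : Prop :=
  [/\ continuous f, forall y, 0 <= f y &
      exists2 delta, 0 < delta & forall y, `|y| <= delta -> f y = 0].

(** For test functions [fine] loses nothing, by [jump_sumE]. *)
Definition jump_sum (f : R -> R) (a h : R) (w : T) : R :=
  fine (\esum_(u in `]a, a + h]) (f (jump X u w))%:E).

Definition incr_sum (f : R -> R) (a h : R) (n : nat) (w : T) : R :=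
  \sum_(i < n.+1) f (X (grid a h n i.+1) w - X (grid a h n i) w).

Lemma incr_sum_cvg f a h w : jump_test f -> 0 <= a -> 0 < h ->
  incr_sum f a h n w @[n --> \oo] --> jump_sum f a h w.
Proof.
move=> [cf f0 [delta d0 fd]] a0 h0.
have := grid_cvg_esum (levy_cadlag LX w) cf f0 fd d0 a0 h0.
by rewrite -(fineK (esum_path_jump_fin (levy_cadlag LX w) f0 fd d0 a0 h0)) => /fine_cvgP[].
Qed.

Lemma jump_sumE f a h w : jump_test f -> 0 <= a -> 0 < h ->
  \esum_(u in `]a, a + h]) (f (jump X u w))%:E = (jump_sum f a h w)%:E.
Proof.
move=> [cf f0 [delta d0 fd]] a0 h0; rewrite /jump_sum fineK//.
exact: (esum_path_jump_fin (levy_cadlag LX w) f0 fd).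
Qed.

Lemma jump_sum_ge0 f a h w : jump_test f -> 0 <= jump_sum f a h w.
Proof.
by case=> _ f0 _; apply: fine_ge0; apply: esum_ge0 => u _; rewrite lee_fin.
Qed.

Lemma measurable_incr_sum f a h n : continuous f ->
  measurable_fun setT (incr_sum f a h n).
Proof.
move=> cf; apply: measurable_sum => i.
apply: (measurableT_comp (continuous_measurable_fun cf)).
exact: measurable_funB.
Qed.

(** Measurability comes from the grid sums, whose pointwise limit this is. *)
Lemma measurable_jump_sum f a h : jump_test f -> 0 <= a -> 0 < h ->
  measurable_fun setT (jump_sum f a h).
Proof.
move=> tf a0 h0; have [cf _ _] := tf.
apply: (measurable_fun_cvg (fun n => measurable_incr_sum a h n cf)) => w _.
exact: incr_sum_cvg.
Qed.

End LevyJumpSums.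

(** * Campbell's formula *)

Lemma expR_unit (R : realType) (y : R) : 0 <= y -> 0 <= expR (- y) <= 1.
Proof. by move=> y0; rewrite expR_ge0 -expR0 ler_expR oppr_le0. Qed.

Lemma measurable_expRN d (T : measurableType d) (R : realType) (h : T -> R) :
  measurable_fun setT h -> measurable_fun setT (fun w => expR (- h w)).
Proof.
by move=> mh; apply: measurableT_comp => //; exact: measurableT_comp.
Qed.

Section Campbell.
Context d (T : measurableType d) (R : realType) (P : probability T R).
Variable X : R -> {RV P >-> R}.
Hypothesis LX : levy_process X.

Let incr_mean (f : R -> R) (h : R) : R := mean P (fun w => expR (- f (X h w))).

Definition laplace (f : R -> R) (a h : R) : R :=
  mean P (fun w => expR (- jump_sum X f a h w)).

(** Stationarity is given for events; [ge0_integral_comp_ext] with constant weights carries it over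
    to functions. *)
Lemma incr_expectation (g : R -> R) s h : measurable_fun setT (g : measurableTypeR R -> R) ->
  (forall y, 0 <= g y) -> 0 <= s -> 0 <= h ->
  (\int[P]_w (g (X (s + h) w - X s w))%:E = \int[P]_w (g (X h w))%:E)%E.
Proof.
move=> mg g0 s0 h0.
transitivity (\int[P]_w ((cst 1 w) * g (X (s + h) w - X s w))%:E)%E.
  by apply: eq_integral => w _; rewrite mul1r.
rewrite (@ge0_integral_comp_ext _ T R P 1 (cst 1) (cst 1)
  (fun w => X (s + h) w - X s w) (X h) g)//.
- by rewrite mul1e; apply: eq_integral => w _; rewrite mul1r.
- exact: measurable_funB.
- exact: (@measurable_funPT _ _ _ _ (X h)).
move=> B mB; rewrite mul1e.
have mB' (Y : T -> R) : measurable_fun setT (Y : T -> measurableTypeR R) ->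
    (\int[P]_w ((cst 1%R w)%:E * (\1_B (Y w))%:E) = P (Y @^-1` B))%E.
  move=> mY; rewrite -[Y @^-1` B]setIT -integral_indic//.
    by apply: eq_integral => w _; rewrite mul1e.
  by rewrite -[X in measurable X]setTI; exact: mY.
have EX : (\int[P]_w ((cst 1%R w)%:E * (\1_B (X h w))%:E) = P (X h @^-1` B))%E.
  by apply: mB'; exact: (@measurable_funPT _ _ _ _ (X h)).
rewrite EX mB'; last exact: measurable_funB.
exact: (levy_stationary LX).
Qed.

Lemma mean_incr_sum f a h n : jump_test f -> 0 <= a -> 0 < h ->
  mean P (fun w => expR (- incr_sum X f a h n w)) =
  incr_mean f (h / n.+1%:R) ^+ n.+1.
Proof.
move=> tf a0 h0; have [cf f0 _] := tf.
pose Y (i : 'I_n.+1) w := X (grid a h n i.+1) w - X (grid a h n i) w.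
pose G (i : 'I_n.+1) (y : measurableTypeR R) : R := expR (- f y).
have mG i : measurable_fun setT (G i).
  by apply: measurable_expRN; exact: continuous_measurable_fun.
have G01 i y : 0 <= G i y <= 1 by exact: expR_unit.
have mY i : measurable_fun setT (Y i : T -> measurableTypeR R) by exact: measurable_funB.
have iY : mutually_independent P Y.
  apply: (levy_independent LX) => [|i ilt]; first by rewrite grid0.
  by apply: le_grid => //; exact: ltW.
rewrite /mean (eq_integral (fun w => (\prod_i G i (Y i w))%:E)); last first.
  move=> w _; congr EFin; rewrite /incr_sum -sumrN.
  by rewrite (big_morph _ (@expRD R) (@expR0 R)).
rewrite (integral_prod_independent mY iY mG G01).
rewrite (eq_bigr (fun=> \int[P]_w (expR (- f (X (h / n.+1%:R) w)))%:E)%E); last first.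
  move=> i _; rewrite -(@incr_expectation (fun y => expR (- f y)) (grid a h n i)).
  - by apply: eq_integral => w _; rewrite /G /Y gridS.
  - by move: (mG i).
  - by move=> y; exact: expR_ge0.
  - by rewrite (le_trans a0)// -[leLHS](grid0 a h n) le_grid// ltW.
  - by rewrite divr_ge0// ltW.
rewrite meanE; [|exact: measurable_expRN (measurableT_comp (continuous_measurable_fun cf) _)|
  by move=> w; exact: expR_unit].
by rewrite prodEFin prodr_const card_ord.
Qed.

Lemma measurable_laplace f a h : jump_test f -> 0 <= a -> 0 < h ->
  measurable_fun setT (fun w => expR (- jump_sum X f a h w)).
Proof. by move=> tf a0 h0; apply/measurable_expRN/measurable_jump_sum. Qed.

Lemma laplace_unit f a h w : jump_test f -> 0 <= expR (- jump_sum X f a h w) <= 1.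
Proof. by move=> tf; apply/expR_unit/jump_sum_ge0. Qed.

Lemma laplace_cvg f a h : jump_test f -> 0 <= a -> 0 < h ->
  incr_mean f (h / n.+1%:R) ^+ n.+1 @[n --> \oo] --> laplace f a h.
Proof.
move=> tf a0 h0; have [cf f0 _] := tf.
under eq_fun do rewrite -(mean_incr_sum _ tf a0 h0).
apply: cvg_mean.
- by move=> n; exact/measurable_expRN/measurable_incr_sum.
- by move=> n w; apply: expR_unit; apply: sumr_ge0.
- move=> w; apply: cvg_comp; last exact: continuous_expR.
  by apply: cvgN; exact: incr_sum_cvg.
Qed.

(** The approximating powers in [laplace_cvg] do not involve [a]. *)
Lemma laplace_shift f a h : jump_test f -> 0 <= a -> 0 < h ->
  laplace f a h = laplace f 0 h.
Proof.
move=> tf a0 h0; apply: (cvg_unique _ (laplace_cvg tf a0 h0)) => //.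
exact: laplace_cvg.
Qed.

(** Cutting ]0, (k + 1) h] into (k + 1)(n + 1) cells gives the mesh of ]0, h] cut into n + 1 cells,
    so along this subsequence the approximation is the (k + 1)-st power of the one for h. *)
Lemma laplace_mul f h k : jump_test f -> 0 < h ->
  laplace f 0 (k.+1%:R * h) = laplace f 0 h ^+ k.+1.
Proof.
move=> tf h0; have kh0 : 0 < k.+1%:R * h by rewrite mulr_gt0.
have sub : (fun n => incr_mean f (h / n.+1%:R) ^+ n.+1 ^+ k.+1) @ \oo --> laplace f 0 (k.+1%:R * h).
  (* The predecessor compensates for the [m.+1] cells of the grid of index [m]. *)
  pose u n := (k.+1 * n.+1).-1.
  have uS n : (u n).+1 = (k.+1 * n.+1)%N by rewrite /u prednK// muln_gt0.
  rewrite (_ : (fun n => _) = (fun m => incr_mean f (k.+1%:R * h / m.+1%:R) ^+ m.+1) \o u); last first.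
    apply/funext => n /=; rewrite uS -exprM mulnC natrM; congr (incr_mean f _ ^+ _).
    have [K0 N0] : k.+1%:R != 0 :> R /\ n.+1%:R != 0 :> R by rewrite !pnatr_eq0.
    by move: K0 N0; move: (k.+1%:R) (n.+1%:R) => K N K0 N0; field; rewrite K0 N0.
  apply: (@cvg_comp _ _ _ u (fun m => incr_mean f (k.+1%:R * h / m.+1%:R) ^+ m.+1) _ _ _ _
    (laplace_cvg tf (lexx 0) kh0)).
  apply/cvgnyPge => m; near=> n.
  rewrite -ltnS uS (@leq_trans n.+1)//; last by rewrite leq_pmull.
  by rewrite ltnS; near: n; exact: nbhs_infty_ge.
have pow : (fun n => incr_mean f (h / n.+1%:R) ^+ n.+1 ^+ k.+1) @ \oo -->
    laplace f 0 h ^+ k.+1.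
  exact: (@cvg_comp _ _ _ (fun n => incr_mean f (h / n.+1%:R) ^+ n.+1)
    (fun y => y ^+ k.+1) _ _ _ (laplace_cvg tf (lexx 0) h0)
    (@exprn_continuous R k.+1 (laplace f 0 h))).
exact: (cvg_unique _ sub pow).
Unshelve. all: by end_near. Qed.

Lemma laplace_gt0 f h : jump_test f -> 0 < h -> 0 < laplace f 0 h.
Proof.
move=> tf h0; apply: mean_gt0.
- exact: measurable_laplace.
- by move=> w; exact: laplace_unit.
- by apply: not_ae_false => w /eqP; rewrite gt_eqF// expR_gt0.
Qed.

Lemma laplace_le1 f h : jump_test f -> 0 < h -> laplace f 0 h <= 1.
Proof.
move=> tf h0; suff /andP[] : 0 <= laplace f 0 h <= 1 by [].
by apply: mean_unit => [|w]; [exact: measurable_laplace|exact: laplace_unit].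
Qed.

End Campbell.

Section ExpMinusOne.
Context {R : realType}.

Definition exp_defect (f : R -> R) (y : R) : R := 1 - expR (- f y).

Lemma exp_defect_test f : jump_test f -> jump_test (exp_defect f).
Proof.
move=> [cf f0 [delta d0 fd]]; split.
- move=> y; apply: cvgB; first exact: cvg_cst.
  apply: (cvg_comp (fun y => - f y)); last exact: continuous_expR.
  by apply: cvgN; exact: cf.
- by move=> y; rewrite /exp_defect subr_ge0; case/andP: (expR_unit (f0 y)).
- by exists delta => // y /fd; rewrite /exp_defect => ->; rewrite oppr0 expR0 subrr.
Qed.

(** With p_i = 1 - exp (- u_i), this is the union bound 1 - prod (1 - p_i) <= sum p_i. *)
Lemma exp_defect_sum (I : eqType) (s : seq I) (u : I -> R) : (forall i, 0 <= u i) ->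
  1 - expR (- \sum_(i <- s) u i) <= \sum_(i <- s) (1 - expR (- u i)).
Proof.
move=> u0; elim: s => [|i s IH]; first by rewrite !big_nil oppr0 expR0 subrr.
rewrite !big_cons opprD expRD.
have /andP[] := expR_unit (u0 i).
have /andP[] : 0 <= expR (- \sum_(j <- s) u j) <= 1 by apply/expR_unit/sumr_ge0.
by move: IH; set a := expR _; set b := expR _; nra.
Qed.

End ExpMinusOne.

Section JumpSumAdditivity.
Context d (T : measurableType d) (R : realType) (P : probability T R).
Variable X : R -> {RV P >-> R}.
Hypothesis LX : levy_process X.

Lemma jump_sumD f a h k w : jump_test f -> 0 <= a -> 0 < h -> 0 < k ->
  jump_sum X f a (h + k) w = jump_sum X f a h w + jump_sum X f (a + h) k w.
Proof.
move=> tf a0 h0 k0; apply: EFin_inj; have [_ f0 _] := tf.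
rewrite EFinD -!(jump_sumE LX)//; [|by rewrite addr_ge0// ltW|by rewrite addr_gt0].
rewrite (esumID `]a, a + h]); last by move=> *; rewrite lee_fin.
congr (_ + _)%E; congr esum; apply/seteqP; split => u /=; rewrite !in_itv /=.
- by case=> _ /andP[-> ->].
- by move=> /andP[-> uah]; split => //=; lra.
- by move=> [/andP[-> ?] /negP]; rewrite -ltNge /= => ?; apply/andP; split; lra.
- move=> /andP[? ?]; split; first by apply/andP; split; lra.
  by apply/negP; rewrite negb_and -!ltNge; apply/orP; right; lra.
Qed.

Lemma jump_sum_grid f h n w : jump_test f -> 0 < h ->
  jump_sum X f 0 (n.+1%:R * h) w = \sum_(i < n.+1) jump_sum X f (i%:R * h) h w.
Proof.
move=> tf h0; elim: n => [|n IH]; first by rewrite big_ord1 mul1r mul0r.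
rewrite big_ord_recr -IH /= -natr1 mulrDl mul1r jump_sumD ?add0r//.
by rewrite mulr_gt0.
Qed.

Lemma exp_defect_jump_sum f a h w : jump_test f -> 0 <= a -> 0 < h ->
  1 - expR (- jump_sum X f a h w) <= jump_sum X (exp_defect f) a h w.
Proof.
move=> tf a0 h0; have [cf f0 [delta d0 fd]] := tf.
have [cg g0 _] := exp_defect_test tf.
have gd y : `|y| <= delta -> exp_defect f y = 0.
  by move=> /fd; rewrite /exp_defect => ->; rewrite oppr0 expR0 subrr.
have cX := levy_cadlag LX w.
have aah : a <= a + h by rewrite lerDl ltW.
have [C HC] := cadlag_almost_constant cX d0 a0 aah.
rewrite /jump_sum.
rewrite (esum_path_jump cX fd a0 HC f0) (esum_path_jump cX gd a0 HC g0) /=.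
exact: exp_defect_sum.
Qed.

End JumpSumAdditivity.

Lemma limn_einf_le (R : realType) (u v : (\bar R)^nat) (l : \bar R) :
  (forall n, u n <= v n)%E -> v @ \oo --> l -> (limn_einf u <= l)%E.
Proof.
move=> uv vl; rewrite limn_einf_lim -(cvg_lim _ vl)//.
apply: lee_lim; [exact: is_cvg_einfs|by apply/cvg_ex; exists l|].
apply: nearW => n; apply: le_trans (uv n).
by apply: ereal_inf_lbound; exists n => //=.
Qed.

Section CampbellFormula.
Context d (T : measurableType d) (R : realType) (P : probability T R).
Variable X : R -> {RV P >-> R}.
Hypothesis LX : levy_process X.

Definition intensity (f : R -> R) (t : R) : \bar R :=
  (\int[P]_w (jump_sum X f 0 t w)%:E)%E.

Lemma meanB (h k : T -> R) : measurable_fun setT h -> measurable_fun setT k ->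
  (forall w, 0 <= k w <= h w) -> (forall w, h w <= 1) ->
  mean P (fun w => h w - k w) = mean P h - mean P k.
Proof.
move=> mh mk kh h1.
have mhk : measurable_fun setT (fun w => h w - k w) by exact: measurable_funB.
have h01 w : 0 <= h w <= 1 by have := kh w; have := h1 w; lra.
have k01 w : 0 <= k w <= 1 by have := kh w; have := h1 w; lra.
have hk01 w : 0 <= h w - k w <= 1 by have := kh w; have := h1 w; lra.
suff : mean P k + mean P (fun w => h w - k w) = mean P h by move=> H; lra.
apply: EFin_inj; rewrite EFinD -!meanE// -ge0_integralD//.
- by apply: eq_integral => w _; rewrite -EFinD; congr EFin; ring.
- by move=> w _; rewrite lee_fin; case/andP: (k01 w).
- exact/measurable_EFinP.
- by move=> w _; rewrite lee_fin; case/andP: (hk01 w).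
- exact/measurable_EFinP.
Qed.

Lemma mean_sub1 (h : T -> R) : measurable_fun setT h ->
  (forall w, 0 <= h w <= 1) -> mean P (fun w => 1 - h w) = 1 - mean P h.
Proof. by move=> mh h01; rewrite meanB// mean_cst. Qed.

Lemma integral_sum_unit (I : Type) (s : seq I) (h : I -> T -> R) :
  (forall i, measurable_fun setT (h i)) -> (forall i w, 0 <= h i w <= 1) ->
  (\int[P]_w (\sum_(i <- s) h i w)%:E = (\sum_(i <- s) mean P (h i))%:E)%E.
Proof.
move=> mh h01.
under eq_integral do rewrite -sumEFin.
rewrite ge0_integral_sum//.
- by rewrite -sumEFin; apply: eq_bigr => i _; rewrite meanE.
- by move=> i; exact/measurable_EFinP.
- by move=> i w _; rewrite lee_fin; case/andP: (h01 i w).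
Qed.

Lemma ln_ge_sub1 (b : R) : 0 < b -> 1 - b <= - ln b.
Proof.
move=> b0; have := @le_ln1Dx R (b - 1) ltac:(lra).
by rewrite addrC subrK; lra.
Qed.

(** Fatou's lemma for the grid sums of 1 - exp (- f). If a_n is the mean of exp (- f) at one
    increment, such a sum has mean (n + 1)(1 - a_n), which is at most - ln (a_n ^ (n + 1)), and this
    converges to the right-hand side. *)
Lemma intensity_le_ln f (t : R) : jump_test f -> 0 < t ->
  (intensity (exp_defect f) t <= (- ln (laplace X f 0 t))%:E)%E.
Proof.
move=> tf t0; have tg := exp_defect_test tf; have [cg g0 _] := tg; have [cf f0 _] := tf.
pose F n w := (incr_sum X (exp_defect f) 0 t n w)%:E.
pose a n := mean P (fun w => expR (- f (X (t / n.+1%:R) w))).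
have h0 n : 0 < t / n.+1%:R by rewrite divr_gt0.
have mexp n : measurable_fun setT (fun w => expR (- f (X (t / n.+1%:R) w))).
  by apply: measurable_expRN; exact: (measurableT_comp (continuous_measurable_fun cf)).
have a01 n : 0 < a n <= 1.
  apply/andP; split.
    apply: mean_gt0 => // [w|]; first exact: expR_unit.
    by apply: not_ae_false => w /eqP; rewrite gt_eqF// expR_gt0.
  suff /andP[] : 0 <= a n <= 1 by [].
  by apply: mean_unit => // w; exact: expR_unit.
have IF n : (\int[P]_w F n w)%E = (n.+1%:R * (1 - a n))%:E.
  pose h (i : 'I_n.+1) w := exp_defect f (X (grid 0 t n i.+1) w - X (grid 0 t n i) w).
  rewrite /F /incr_sum (@integral_sum_unit _ _ h).
  - rewrite (eq_bigr (fun=> 1 - a n)); first by rewrite sumr_const card_ord mulr_natl.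
    move=> i _; rewrite -(mean_sub1 (mexp n)); last by move=> w; exact: expR_unit.
    have gi0 : 0 <= grid 0 t n i by rewrite -[leLHS](grid0 0 t n) le_grid// ltW.
    have := @incr_expectation _ _ _ P X LX (exp_defect f) _ _
      (continuous_measurable_fun cg) g0 gi0 (ltW (h0 n)).
    by rewrite -gridS => /(congr1 fine).
  - move=> i; apply: (measurableT_comp (continuous_measurable_fun cg)).
    exact: measurable_funB.
  - move=> i w; rewrite /h g0 /= /exp_defect lerBlDr lerDl; exact: expR_ge0.
have mF n : measurable_fun setT (F n).
  by apply/measurable_EFinP; exact: measurable_incr_sum.
have F0 n w : setT w -> (0 <= F n w)%E.
  by move=> _; rewrite lee_fin; apply: sumr_ge0.
have := fatou P measurableT mF F0.
rewrite (eq_integral (fun w => (jump_sum X (exp_defect f) 0 t w)%:E)); last first.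
  move=> w _.
  have icvg := @incr_sum_cvg _ _ _ P X LX _ _ _ w tg (lexx 0) t0.
  have /cvg_limn_einf_sup[-> //] : F n w @[n --> \oo] --> (jump_sum X (exp_defect f) 0 t w)%:E.
  by apply/fine_cvgP; split; [near=> n|exact: icvg].
move=> /le_trans; apply.
apply: (@limn_einf_le _ _ (fun n => (- ln (a n ^+ n.+1))%:E)).
  move=> n; rewrite IF lee_fin lnXn; last by case/andP: (a01 n).
  rewrite -mulNrn -[(- ln _) *+ _]mulr_natl ler_wpM2l// ln_ge_sub1//.
  by case/andP: (a01 n).
apply/fine_cvgP; split; first by near=> n.
apply: cvgN; apply: (@cvg_comp _ _ _ (fun n => a n ^+ n.+1) (@ln R) _ _ _
  (laplace_cvg LX tf (lexx 0) t0)).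
by apply: continuous_ln; exact: laplace_gt0.
Unshelve. all: by end_near. Qed.

Lemma intensity_fin_num f t : jump_test f -> 0 < t ->
  intensity (exp_defect f) t \is a fin_num.
Proof.
move=> tf t0; rewrite ge0_fin_numE.
  by rewrite (le_lt_trans (intensity_le_ln tf t0))// ltry.
apply: integral_ge0 => w _; rewrite lee_fin; apply: jump_sum_ge0.
exact: exp_defect_test.
Qed.

(** On each of n + 1 equal pieces of ]0, t], 1 - exp (- S_f) is at most the sum of 1 - exp (- f); by
    shift invariance the pieces have equal means. *)
Lemma laplace_sub_le_intensity f t n : jump_test f -> 0 < t ->
  ((n.+1%:R * (1 - laplace X f 0 (t / n.+1%:R)))%:E <= intensity (exp_defect f) t)%E.
Proof.
move=> tf t0; have tg := exp_defect_test tf.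
set h := t / n.+1%:R; have h0 : 0 < h by rewrite divr_gt0.
pose u (i : 'I_n.+1) w := 1 - expR (- jump_sum X f (i%:R * h) h w).
have ih0 (i : 'I_n.+1) : 0 <= i%:R * h by rewrite mulr_ge0// ltW.
have mu i : measurable_fun setT (u i).
  by apply: measurable_funB => //; exact: measurable_laplace.
have u01 i w : 0 <= u i w <= 1.
  by have := @laplace_unit _ _ _ _ X f (i%:R * h) h w tf; rewrite /u ; lra.
have -> : ((n.+1%:R * (1 - laplace X f 0 h))%:E =
    \int[P]_w (\sum_(i < n.+1) u i w)%:E)%E.
  rewrite integral_sum_unit//; congr EFin.
  rewrite (eq_bigr (fun=> 1 - laplace X f 0 h)).
    by rewrite sumr_const card_ord mulr_natl.
  move=> i _; rewrite mean_sub1; [|exact: measurable_laplace|by move=> w; exact: laplace_unit].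
  by rewrite -/(laplace X f (i%:R * h) h) laplace_shift.
apply: ge0_le_integral => //.
- by move=> w _; rewrite lee_fin sumr_ge0// => i _; case/andP: (u01 i w).
- by apply/measurable_EFinP; exact: measurable_sum.
- by apply/measurable_EFinP; exact: measurable_jump_sum.
- move=> w _; rewrite lee_fin.
  have -> : t = n.+1%:R * h by rewrite /h mulrC divfK// pnatr_eq0.
  rewrite jump_sum_grid//; apply: ler_sum => i _.
  exact: exp_defect_jump_sum.
Qed.

Let loglap f t := - ln (laplace X f 0 t).

Let loglapM f t n : jump_test f -> 0 < t -> loglap f (n.+1%:R * t) = n.+1%:R * loglap f t.
Proof.
move=> tf t0; rewrite /loglap laplace_mul// lnXn ?laplace_gt0//.
by rewrite -mulNrn mulr_natl.
Qed.

Let loglap_ge0 f t : jump_test f -> 0 < t -> 0 <= loglap f t.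
Proof. by move=> tf t0; rewrite oppr_ge0 ln_le0// laplace_le1. Qed.

Lemma intensityE f t : jump_test f -> 0 < t ->
  intensity (exp_defect f) t = (- ln (laplace X f 0 t))%:E.
Proof.
move=> tf t0; apply/eqP; rewrite eq_le intensity_le_ln//=.
have Ifin := intensity_fin_num tf t0.
rewrite -(fineK Ifin) lee_fin -/(loglap f t).
set L := fine _.
(* For l = [loglap f t] / (n + 1), [laplace_sub_le_intensity] reads (n + 1)(1 - exp (- l)) <= L, and
   1 - exp (- l) >= l - l ^ 2. *)
have H n : loglap f t * (1 - loglap f t / n.+1%:R) <= L.
  have N0 : n.+1%:R != 0 :> R by rewrite pnatr_eq0.
  have h0 : 0 < t / n.+1%:R by rewrite divr_gt0.
  have := loglapM n tf h0; rewrite mulrC divfK// => ->.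
  have := laplace_sub_le_intensity n tf t0; rewrite -(fineK Ifin) lee_fin -/L.
  have := laplace_gt0 LX tf h0; have := loglap_ge0 tf h0; rewrite /loglap.
  move: (laplace _ _ _ _) => b l0 b0.
  apply: le_trans; rewrite -mulrA ler_wpM2l// mulrAC mulfV// mul1r.
  have := @expR_ge1Dx R (- ln b).
  have : expR (- ln b) * b = 1 by rewrite expRN lnK ?posrE// mulVf// gt_eqF.
  move: (- ln b) l0 => l l0 bE el.
  have bl : b * (1 + l) <= 1 by have := ler_wpM2l (ltW b0) el; lra.
  have l3 : 0 <= l * l * l by rewrite !mulr_ge0.
  (* The right-hand side is 1 + l ^ 3. *)
  have : b * (1 + l) <= (1 - l + l * l) * (1 + l) by lra.
  by rewrite ler_pM2r; lra.
apply/ler_addgt0Pr => e e0.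
pose l := loglap f t.
have [n Hn] := filter_ex (near_mesh (l * l) e0).
move: Hn (H n); rewrite -/l; move: (n.+1%:R^-1) => q *; lra.
Qed.

End CampbellFormula.

Section CampbellLinear.
Context d (T : measurableType d) (R : realType) (P : probability T R).
Variable X : R -> {RV P >-> R}.
Hypothesis LX : levy_process X.

Let l f t := - ln (laplace X f 0 t).

Let le_l f s t : jump_test f -> 0 < s -> s <= t -> l f s <= l f t.
Proof.
move=> tf s0; rewrite le_eqVlt => /predU1P[->//|st].
have t0 := lt_trans s0 st.
have ps : laplace X f 0 s \in Num.pos by rewrite posrE (laplace_gt0 LX tf s0).
have pt : laplace X f 0 t \in Num.pos by rewrite posrE (laplace_gt0 LX tf t0).
rewrite /l lerN2 (ler_ln pt ps).
apply: le_mean.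
- exact: measurable_laplace.
- exact: measurable_laplace.
- by move=> w; exact: laplace_unit.
- by move=> w; exact: laplace_unit.
move=> w; rewrite ler_expR lerN2.
have -> : t = s + (t - s) by ring.
by rewrite (jump_sumD LX)// ?subr_gt0// lerDl jump_sum_ge0.
Qed.

Let l_ge0 f t : jump_test f -> 0 < t -> 0 <= l f t.
Proof. by move=> tf t0; rewrite /l oppr_ge0; apply: ln_le0; exact: laplace_le1. Qed.

Let l_nat f t n : jump_test f -> 0 < t -> l f (n.+1%:R * t) = n.+1%:R * l f t.
Proof.
move=> tf t0; rewrite /l laplace_mul// lnXn ?laplace_gt0//.
by rewrite -mulNrn mulr_natl.
Qed.

(** Monotone and homogeneous under integers, hence linear: with k the integer part of (n + 1) t,
    both (n + 1) l(t) and (n + 1) t l(1) lie between k l(1) and (k + 1) l(1). *)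
Let l_linear f t : jump_test f -> 0 < t -> l f t = t * l f 1.
Proof.
move=> tf t0; apply/eqP; rewrite -subr_eq0 -normr_le0.
have l10 : 0 <= l f 1 by exact: l_ge0.
apply/ler_addgt0Pr => e e0; rewrite add0r.
have [n Hn] := filter_ex (near_mesh (l f 1) e0).
have N0 : 0 < n.+1%:R :> R by rewrite ltr0n.
apply: le_trans (ltW Hn); rewrite ler_pdivlMr// mulrC.
have nt0 : 0 < n.+1%:R * t by rewrite mulr_gt0.
have /andP[kn nk] := Num.Theory.truncn_itv (ltW nt0).
set k := Num.truncn _ in kn nk.
have up : n.+1%:R * l f t <= k.+1%:R * l f 1.
  by rewrite -(l_nat n tf t0) -(l_nat k tf ltr01) mulr1; apply: le_l => //; exact: ltW.
have dn : k%:R * l f 1 <= n.+1%:R * l f t.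
  (* k = 0 is treated apart because [l_nat] covers only successors. *)
  case: k kn {nk up} => [_|k kn].
    by rewrite mul0r; apply: mulr_ge0; [exact: ltW|exact: l_ge0].
  by rewrite -(l_nat n tf t0) -(l_nat k tf ltr01) mulr1; apply: le_l.
have a1 := ler_wpM2r l10 kn.
have a2 := ler_wpM2r l10 (ltW nk).
rewrite -[X in X * _](gtr0_norm N0) -normrM mulrBr ler_norml.
move: up dn a1 a2; rewrite -[k.+1%:R]natr1 !mulrDl !mul1r mulrA.
move: (l f t) (l f 1) (n.+1%:R) (k%:R) => A B N K up dn a1 a2.
by apply/andP; split; lra.
Qed.

(* Sealed, so that comparing two rates does not unfold the integrals. *)
Lemma rate_subdef f : {r : R | r = fine (intensity X (exp_defect f) 1)}.
Proof. by eexists. Qed.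

Definition rate f : R := sval (rate_subdef f).

Lemma rate_def f : rate f = fine (intensity X (exp_defect f) 1).
Proof. exact: (svalP (rate_subdef f)). Qed.

Lemma rateE f : jump_test f -> intensity X (exp_defect f) 1 = (rate f)%:E.
Proof. by move=> tf; rewrite rate_def fineK// (intensity_fin_num LX). Qed.

Theorem campbell f t : jump_test f -> 0 < t ->
  laplace X f 0 t = expR (- (t * rate f)).
Proof.
move=> tf t0; rewrite rate_def (intensityE LX tf ltr01) /= -/(l f 1) -(l_linear tf t0) /l opprK.
by rewrite lnK// posrE (laplace_gt0 LX tf t0).
Qed.

End CampbellLinear.

(** * Rates and tails *)

Section MaxMinContinuity.
Context {R : realType} {I : Type} (F : set_system I) (FF : Filter F).
Implicit Types f g : I -> R.

Lemma cvg_maxr f g (a b : R) : f @ F --> a -> g @ F --> b ->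
  Num.max (f i) (g i) @[i --> F] --> Num.max a b.
Proof.
move=> fa gb; under eq_fun do rewrite maxr_absE.
rewrite maxr_absE; apply: cvgM; last exact: cvg_cst.
by apply: cvgD; [exact: cvgD|apply: cvg_norm; exact: cvgB].
Qed.

Lemma cvg_minr f g (a b : R) : f @ F --> a -> g @ F --> b ->
  Num.min (f i) (g i) @[i --> F] --> Num.min a b.
Proof.
move=> fa gb; under eq_fun do rewrite minr_absE.
rewrite minr_absE; apply: cvgM; last exact: cvg_cst.
by apply: cvgB; [exact: cvgD|apply: cvg_norm; exact: cvgB].
Qed.

End MaxMinContinuity.

Section JumpFunctions.
Context d (T : measurableType d) (R : realType) (P : probability T R).
Variable X : R -> {RV P >-> R}.
Hypothesis LX : levy_process X.

Definition null_below (delta : R) (f : R -> R) : Prop :=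
  (forall y, 0 <= f y) /\ (forall y, `|y| <= delta -> f y = 0).

(** One list of times serves all functions null below [delta], so identities and inequalities
    between finite sums pass to jump sums. *)
Lemma jump_sum_repr delta a h w : 0 < delta -> 0 <= a -> 0 < h ->
  exists s : seq R, forall f, null_below delta f ->
    jump_sum X f a h w = \sum_(c <- s) f (jump X c w).
Proof.
move=> d0 a0 h0.
have cX := levy_cadlag LX w.
have aah : a <= a + h by rewrite lerDl ltW.
have [C HC] := cadlag_almost_constant cX d0 a0 aah.
by eexists => f [f0 fd]; rewrite /jump_sum (esum_path_jump cX fd a0 HC f0).
Qed.

Lemma le_jump_sum delta f g a h w : 0 < delta -> 0 <= a -> 0 < h ->
  null_below delta f -> null_below delta g -> (forall y, f y <= g y) ->
  jump_sum X f a h w <= jump_sum X g a h w.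
Proof.
move=> d0 a0 h0 Hf Hg fg; have [s Hs] := jump_sum_repr w d0 a0 h0.
by rewrite !Hs//; apply: ler_sum.
Qed.

Lemma jump_sum_lin (I : Type) (s : seq I) (k : I -> R) (f : I -> R -> R) delta a h w :
  0 < delta -> 0 <= a -> 0 < h -> (forall i, 0 <= k i) ->
  (forall i, null_below delta (f i)) ->
  jump_sum X (fun y => \sum_(i <- s) k i * f i y) a h w =
  \sum_(i <- s) k i * jump_sum X (f i) a h w.
Proof.
move=> d0 a0 h0 k0 Hf; have [r Hr] := jump_sum_repr w d0 a0 h0.
rewrite Hr; last first.
  split=> [y|y yd]; first by apply: sumr_ge0 => i _; rewrite mulr_ge0//; case: (Hf i).
  by rewrite big1// => i _; case: (Hf i) => _ ->//; rewrite mulr0.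
by rewrite exchange_big; apply: eq_bigr => i _; rewrite Hr// mulr_sumr.
Qed.

Lemma cvg_jump_sum delta (g_ : nat -> R -> R) g a h w :
  0 < delta -> 0 <= a -> 0 < h -> (forall n, null_below delta (g_ n)) ->
  null_below delta g -> (forall y, g_ n y @[n --> \oo] --> g y) ->
  jump_sum X (g_ n) a h w @[n --> \oo] --> jump_sum X g a h w.
Proof.
move=> d0 a0 h0 Hg_ Hg gg; have [s Hs] := jump_sum_repr w d0 a0 h0.
rewrite Hs//; under eq_fun do rewrite Hs//.
by apply: (cvg_big (@add_continuous R)) => c _; exact: gg.
Qed.

(** At a jump this is convertible to [jump_pos] for [true] and to [jump_neg] for [false]. *)
Definition side (b : bool) (y : R) : R := Num.max (if b then y else - y) 0.

Lemma side_ge0 b y : 0 <= side b y.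
Proof. by rewrite /side le_max lexx orbT. Qed.

Lemma side_le b y : side b y <= `|y|.
Proof.
rewrite /side ge_max normr_ge0 andbT; case: b; first exact: ler_norm.
by rewrite -normrN ler_norm.
Qed.

Lemma continuous_side b : continuous (side b).
Proof.
move=> y; rewrite /side; case: b.
  by apply: cvg_maxr; [exact: cvg_id|exact: cvg_cst].
by apply: cvg_maxr; [apply: cvgN; exact: cvg_id|exact: cvg_cst].
Qed.

Definition above b (y v : R) : R := (y < side b v)%R%:R.

Lemma above_null b y : null_below y (above b y).
Proof.
split=> v; first exact: ler0n.
by move=> vy; rewrite /above ltNge (le_trans (side_le b v) vy).
Qed.

(** Test functions increasing to the discontinuous [above b y]. *)
Definition above_approx b (y : R) (n : nat) (v : R) : R :=
  Num.min 1 (n.+1%:R * Num.max (side b v - y) 0).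

Lemma above_approx_ge0 b y n v : 0 <= above_approx b y n v.
Proof. by rewrite /above_approx le_min ler01/= mulr_ge0// le_max lexx orbT. Qed.

Lemma above_approx_null b y n : 0 < y -> null_below y (above_approx b y n).
Proof.
move=> y0; split=> v; first exact: above_approx_ge0.
move=> vy; rewrite /above_approx.
have := le_trans (side_le b v) vy; rewrite -subr_le0 => /max_idPr ->.
by rewrite mulr0; apply/min_idPr.
Qed.

Lemma above_approx_test b y n : 0 < y -> jump_test (above_approx b y n).
Proof.
move=> y0; split.
- move=> v; apply: cvg_minr; first exact: cvg_cst.
  apply: cvgM; first exact: cvg_cst.
  apply: cvg_maxr; last exact: cvg_cst.
  by apply: cvgB; [exact: continuous_side|exact: cvg_cst].
- exact: above_approx_ge0.
- by exists y => //; case: (above_approx_null b n y0).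
Qed.

Lemma above_approx_cvg b y v : above_approx b y n v @[n --> \oo] --> above b y v.
Proof.
rewrite /above; have [yv|vy] := ltP y (side b v).
  have d0 : 0 < side b v - y by rewrite subr_gt0.
  apply: cvg_near_cst; near=> n.
  rewrite /above_approx; apply/min_idPl.
  rewrite (max_idPl (ltW d0)).
  have : 1 / n.+1%:R < side b v - y by near: n; exact: near_mesh.
  by rewrite ltr_pdivrMr// mulrC => /ltW.
apply: cvg_near_cst; near=> n; rewrite /above_approx.
have -> : Num.max (side b v - y) 0 = 0 by apply/max_idPr; rewrite subr_le0.
by rewrite mulr0; apply/min_idPr.
Unshelve. all: by end_near. Qed.

Lemma above_approx_nd b y v m n : (m <= n)%N ->
  above_approx b y m v <= above_approx b y n v.
Proof.
move=> mn; rewrite /above_approx le_min ge_min lexx/= ge_min.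
by apply/orP; right; rewrite ler_wpM2r ?ler_nat// le_max lexx orbT.
Qed.

Lemma measurable_above_sum b y a h : 0 < y -> 0 <= a -> 0 < h ->
  measurable_fun setT (jump_sum X (above b y) a h).
Proof.
move=> y0 a0 h0.
apply: (@measurable_fun_cvg _ _ _ _ (fun n => jump_sum X (above_approx b y n) a h)).
  by move=> n; apply: measurable_jump_sum => //; exact: above_approx_test.
move=> w _; apply: (@cvg_jump_sum y (above_approx b y)) => //.
- by move=> n; exact: above_approx_null.
- exact: above_null.
- by move=> v; exact: above_approx_cvg.
Qed.

Lemma above_sum_approx b y : 0 < y ->
  (\int[P]_w (jump_sum X (above_approx b y n) 0 1 w)%:E)%E @[n --> \oo] -->
  (\int[P]_w (jump_sum X (above b y) 0 1 w)%:E)%E.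
Proof.
move=> y0.
have nb := above_approx_null b _ y0; have ab := above_null b y.
have pw w : (jump_sum X (above_approx b y n) 0 1 w)%:E @[n --> \oo] -->
    (jump_sum X (above b y) 0 1 w)%:E.
  apply/fine_cvgP; split; first by near=> n.
  by apply: (@cvg_jump_sum y (above_approx b y)) => // v; exact: above_approx_cvg.
rewrite (_ : (fun w => (jump_sum X (above b y) 0 1 w)%:E) =
  (fun w => limn (fun n => (jump_sum X (above_approx b y n) 0 1 w)%:E))); last first.
  by apply/funext => w; apply/esym/cvg_lim => //; exact: pw.
apply: cvg_monotone_convergence => //.
- move=> n; apply/measurable_EFinP; apply: measurable_jump_sum => //.
  exact: above_approx_test.
- by move=> n w _; rewrite lee_fin; apply: jump_sum_ge0; exact: above_approx_test.
- move=> w _ m n mn; rewrite lee_fin; apply: (@le_jump_sum y) => // v.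
  exact: above_approx_nd.
Unshelve. all: by end_near. Qed.

End JumpFunctions.

(** 1 - exp (- u) >= u / (1 + u), which is at least u / 2 for u <= 1 and at least 1 / 2 beyond. *)
Lemma exp_defect_ge (R : realType) (u : R) : 0 <= u -> Num.min 1 u <= 2 * (1 - expR (- u)).
Proof.
move=> u0; have E := @expR_ge1Dx R u.
have Ei : expR (- u) * expR u = 1 by rewrite -expRD addNr expR0.
have e0 := expR_ge0 (- u).
have H : expR (- u) * (1 + u) <= 1 by have := ler_wpM2l e0 E; lra.
have [u1|u1] := leP 1 u; nra.
Qed.

Lemma exp_defect_le (R : realType) (u : R) : 1 - expR (- u) <= Num.min 1 u.
Proof.
have := @expR_ge1Dx R (- u); have := expR_ge0 (- u).
have [u1|u1] := leP 1 u; lra.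
Qed.

Section Rates.
Context d (T : measurableType d) (R : realType) (P : probability T R).
Variable X : R -> {RV P >-> R}.
Implicit Types (f g : R -> R) (y z : R).
Hypothesis LX : levy_process X.

Lemma rate_ge0 f : jump_test f -> 0 <= rate X f.
Proof.
move=> tf; rewrite rate_def; apply: fine_ge0; apply: integral_ge0 => w _; rewrite lee_fin.
by apply: jump_sum_ge0; exact: exp_defect_test.
Qed.

Lemma jump_sum_above_ge0 b y w : 0 <= jump_sum X (above b y) 0 1 w.
Proof. by apply: fine_ge0; apply: esum_ge0 => u _; rewrite lee_fin ler0n. Qed.

Lemma jump_test_null f : jump_test f -> exists2 delta, 0 < delta &
  null_below delta f /\ null_below delta (exp_defect f).
Proof.
move=> tf; have [_ f0 [delta d0 fd]] := tf; have [_ g0 _] := exp_defect_test tf.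
exists delta => //; split; split => // y /fd; rewrite /exp_defect => ->.
by rewrite oppr0 expR0 subrr.
Qed.

Lemma null_below_le delta eta (f : R -> R) : eta <= delta ->
  null_below delta f -> null_below eta f.
Proof. by move=> ed [f0 fd]; split => // y ye; apply: fd; exact: le_trans ed. Qed.

Lemma jump_test_null2 f g : jump_test f -> jump_test g ->
  exists2 delta, 0 < delta & [/\ null_below delta f, null_below delta g,
    null_below delta (exp_defect f) & null_below delta (exp_defect g)].
Proof.
move=> tf tg.
have [d1 d10 [nf nf']] := jump_test_null tf.
have [d2 d20 [ng ng']] := jump_test_null tg.
have m1 : Num.min d1 d2 <= d1 by rewrite ge_min lexx.
have m2 : Num.min d1 d2 <= d2 by rewrite ge_min lexx orbT.
exists (Num.min d1 d2); first by rewrite lt_min d10.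
by split; [exact: null_below_le nf|exact: null_below_le ng|
  exact: null_below_le nf'|exact: null_below_le ng'].
Qed.

Lemma measurable_exp_defect_sum f : jump_test f ->
  measurable_fun setT (fun w => (jump_sum X (exp_defect f) 0 1 w)%:E).
Proof.
move=> tf; apply/measurable_EFinP; apply: measurable_jump_sum => //.
exact: exp_defect_test.
Qed.

Lemma le_rate f g : jump_test f -> jump_test g -> (forall y, f y <= g y) ->
  rate X f <= rate X g.
Proof.
move=> tf tg fg; rewrite -lee_fin -[X in (X <= _)%E](rateE LX tf) -[X in (_ <= X)%E](rateE LX tg).
have [delta d0 [_ _ nf ng]] := jump_test_null2 tf tg.
apply: ge0_le_integral => //.
- by move=> w _; rewrite lee_fin; apply: jump_sum_ge0; exact: exp_defect_test.
- exact: measurable_exp_defect_sum.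
- exact: measurable_exp_defect_sum.
- move=> w _; rewrite lee_fin; apply: (@le_jump_sum _ _ _ _ _ LX _ _ _ _ _ _ d0) => // y.
  by rewrite /exp_defect lerD2l lerN2 ler_expR lerN2.
Qed.

(** Where f or g vanishes, 1 - exp (- (f + g)) is the sum of the two defects. Independence of
    positive and negative jumps will come from here. *)
Lemma rateD f g : jump_test f -> jump_test g -> (forall y, f y = 0 \/ g y = 0) ->
  jump_test (fun y => f y + g y) /\ rate X (fun y => f y + g y) = rate X f + rate X g.
Proof.
move=> tf tg fg0; have [cf f0 _] := tf; have [cg g0 _] := tg.
have [delta d0 [nf ng ef eg]] := jump_test_null2 tf tg.
have tfg : jump_test (fun y => f y + g y).
  split; first by move=> y; apply: cvgD; [exact: cf|exact: cg].
    by move=> y; rewrite addr_ge0.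
  exists delta => // y yd; case: nf => _ ->//; case: ng => _ ->//.
  by rewrite addr0.
split=> //; apply: EFin_inj; rewrite EFinD -[LHS](rateE LX tfg) -[X in (X + _)%E](rateE LX tf) -[X in (_ + X)%E](rateE LX tg) -ge0_integralD//.
- apply: eq_integral => w _; rewrite -EFinD; congr EFin.
  have [s Hs] := jump_sum_repr LX w d0 (lexx 0) ltr01.
  rewrite !Hs//.
    rewrite -big_split; apply: eq_bigr => c _ /=; rewrite /exp_defect.
    by case: (fg0 (jump X c w)) => ->; rewrite ?add0r ?addr0 oppr0 expR0 subrr ?add0r ?addr0.
  split=> y; first by case: (exp_defect_test tfg).
  case: nf => _ nf; case: ng => _ ng /[dup] /nf + /ng; rewrite /exp_defect => -> ->.
  by rewrite addr0 oppr0 expR0 subrr.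
- by move=> w _; rewrite lee_fin; apply: jump_sum_ge0; exact: exp_defect_test.
- exact: measurable_exp_defect_sum.
- by move=> w _; rewrite lee_fin; apply: jump_sum_ge0; exact: exp_defect_test.
- exact: measurable_exp_defect_sum.
Qed.

Definition above_count b y : \bar R := (\int[P]_w (jump_sum X (above b y) 0 1 w)%:E)%E.

Definition above_rate b y : R := fine (above_count b y).

Lemma above_count_le b y f C : 0 < y -> jump_test f -> 0 <= C ->
  (forall v, above b y v <= C * exp_defect f v) ->
  (above_count b y <= (C * rate X f)%:E)%E.
Proof.
move=> y0 tf C0 H; have tg := exp_defect_test tf.
rewrite EFinM -[X in (_ <= _ * X)%E](rateE LX tf) -ge0_integralZl_EFin//; last 2 first.
- by move=> w _; rewrite lee_fin; exact: jump_sum_ge0.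
- exact: measurable_exp_defect_sum.
have [delta d0 [_ nf]] := jump_test_null tf.
apply: ge0_le_integral => //.
- by move=> w _; rewrite lee_fin; exact: jump_sum_above_ge0.
- by apply/measurable_EFinP; exact: measurable_above_sum.
- by apply: emeasurable_funM => //; exact: measurable_exp_defect_sum.
move=> w _; rewrite -EFinM lee_fin.
have md0 : 0 < Num.min y delta by rewrite lt_min y0.
have [s Hs] := jump_sum_repr LX w md0 (lexx 0) ltr01.
rewrite !Hs.
- by rewrite mulr_sumr; apply: ler_sum.
- by apply: null_below_le nf; rewrite ge_min lexx orbT.
- by apply: (null_below_le _ (above_null b y)); rewrite ge_min lexx.
Qed.

Lemma above_count_fin b y : 0 < y -> above_count b y \is a fin_num.
Proof.
move=> y0; have y20 : 0 < y / 2 by rewrite divr_gt0.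
(* The slope [n.+1] exceeds 2 / y, so [above_approx b (y / 2) n] equals 1 above [y], and the count
   is at most twice its finite rate. *)
have [n Hn] := filter_ex (near_mesh 1 y20).
rewrite ge0_fin_numE; last first.
  by apply: integral_ge0 => w _; rewrite lee_fin; exact: jump_sum_above_ge0.
apply: (@le_lt_trans _ _ (2 * rate X (above_approx b (y / 2) n))%:E); last exact: ltry.
apply: above_count_le => //; first exact: above_approx_test.
move=> v; rewrite /exp_defect; apply: le_trans (exp_defect_ge (above_approx_ge0 _ _ _ _)).
rewrite /above; have [yv|_] := ltP y (side b v); last first.
  by rewrite le_min ler01 above_approx_ge0.
rewrite le_min lexx/= /above_approx le_min lexx/=.
have p : 0 <= side b v - y / 2 by lra.
rewrite (max_idPl p); move: Hn; rewrite ltr_pdivrMr// mulrC => Hn.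
by rewrite (le_trans (ltW Hn))// ler_wpM2l//; lra.
Qed.

Lemma above_rateE b y : 0 < y -> above_count b y = (above_rate b y)%:E.
Proof. by move=> y0; rewrite /above_rate fineK// above_count_fin. Qed.

Lemma above_rate_ge0 b y : 0 <= above_rate b y.
Proof.
by apply: fine_ge0; apply: integral_ge0 => w _; rewrite lee_fin; exact: jump_sum_above_ge0.
Qed.

Lemma le_above_rate b y z : 0 < y -> y <= z -> above_rate b z <= above_rate b y.
Proof.
move=> y0 yz; have z0 := lt_le_trans y0 yz.
rewrite -lee_fin -[X in (_ <= X)%E](above_rateE b y0) -[X in (X <= _)%E](above_rateE b z0); apply: ge0_le_integral => //.
- by move=> w _; rewrite lee_fin; exact: jump_sum_above_ge0.
- by apply/measurable_EFinP; exact: measurable_above_sum.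
- by apply/measurable_EFinP; exact: measurable_above_sum.
move=> w _; rewrite lee_fin; apply: (@le_jump_sum _ _ _ _ _ LX _ _ _ _ _ _ y0) => //.
- exact: null_below_le yz (above_null b z).
- exact: above_null.
- move=> v; rewrite /above; case: (ltP z) => // zv; first by rewrite (le_lt_trans yz zv).
Qed.

Let steps_sum (I : Type) (s : seq I) (k y : I -> R) b delta w :
  0 < delta -> (forall i, 0 <= k i) -> (forall i, delta <= y i) ->
  jump_sum X (fun v => \sum_(i <- s) k i * above b (y i) v) 0 1 w =
  \sum_(i <- s) k i * jump_sum X (above b (y i)) 0 1 w.
Proof.
move=> d0 k0 yd.
apply: (@jump_sum_lin _ _ _ _ _ LX I s k (fun i => above b (y i)) delta) => //.
by move=> i; exact: null_below_le (yd i) (above_null b (y i)).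
Qed.

Lemma integral_steps (I : Type) (s : seq I) (k y : I -> R) b delta :
  0 < delta -> (forall i, 0 <= k i) -> (forall i, delta <= y i) ->
  (\int[P]_w (jump_sum X (fun v => \sum_(i <- s) k i * above b (y i) v)%R 0 1 w)%:E =
   (\sum_(i <- s) k i * above_rate b (y i))%:E)%E.
Proof.
move=> d0 k0 yd; have y0 i : 0 < y i by exact: lt_le_trans (yd i).
rewrite (eq_integral (fun w => \sum_(i <- s) (k i * jump_sum X (above b (y i)) 0 1 w)%:E)%E); last first.
  by move=> w _; rewrite sumEFin; congr EFin; exact: (@steps_sum _ _ _ _ _ delta).
rewrite ge0_integral_sum//; last 2 first.
- move=> i; apply/measurable_EFinP; apply: measurable_funM => //.
  exact: measurable_above_sum.
- by move=> i w _; rewrite lee_fin mulr_ge0// jump_sum_above_ge0.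
rewrite -sumEFin; apply: eq_bigr => i _.
rewrite EFinM -[X in (_ = _ * X)%E]above_rateE// -ge0_integralZl_EFin//.
- by move=> w _; rewrite lee_fin; exact: jump_sum_above_ge0.
- by apply/measurable_EFinP; exact: measurable_above_sum.
Qed.

Let measurable_steps (I : Type) (s : seq I) (k y : I -> R) b delta :
  0 < delta -> (forall i, 0 <= k i) -> (forall i, delta <= y i) ->
  measurable_fun setT
    (fun w => (jump_sum X (fun v => \sum_(i <- s) k i * above b (y i) v)%R 0 1 w)%:E).
Proof.
move=> d0 k0 yd; have y0 i : 0 < y i by exact: lt_le_trans (yd i).
apply/measurable_EFinP.
rewrite (_ : jump_sum X _ 0 1 =
    (fun w => \sum_(i <- s) k i * jump_sum X (above b (y i)) 0 1 w)); last first.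
  by apply/funext => w; exact: (@steps_sum _ _ _ _ _ delta).
apply: measurable_sum => i; apply: measurable_funM => //.
exact: measurable_above_sum.
Qed.

Let steps_null (I : Type) (s : seq I) (k y : I -> R) b delta :
  (forall i, 0 <= k i) -> (forall i, delta <= y i) ->
  null_below delta (fun v => \sum_(i <- s) k i * above b (y i) v).
Proof.
move=> k0 yd; split=> v; first by apply: sumr_ge0 => i _; rewrite mulr_ge0// ler0n.
move=> vd; rewrite big1// => i _.
by have [_ ->] := null_below_le (yd i) (above_null b (y i)); rewrite ?mulr0.
Qed.

(** A pointwise comparison with a step function bounds a rate by finitely many tail values; [delta]
    keeps the thresholds away from 0. The next lemma is the reverse comparison. *)
Lemma rate_le_steps (I : Type) (s : seq I) (k y : I -> R) b delta f :
  0 < delta -> (forall i, 0 <= k i) -> (forall i, delta <= y i) -> jump_test f ->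
  (forall v, exp_defect f v <= \sum_(i <- s) k i * above b (y i) v) ->
  rate X f <= \sum_(i <- s) k i * above_rate b (y i).
Proof.
move=> d0 k0 yd tf H; rewrite -lee_fin -[X in (X <= _)%E](rateE LX tf) -[X in (_ <= X)%E](@integral_steps _ s k y b delta)//.
have [eta e0 [_ nf]] := jump_test_null tf.
apply: ge0_le_integral => //.
- by move=> w _; rewrite lee_fin; apply: jump_sum_ge0; exact: exp_defect_test.
- exact: measurable_exp_defect_sum.
- exact: measurable_steps yd.
move=> w _; rewrite lee_fin.
have m0 : 0 < Num.min eta delta by rewrite lt_min e0.
apply: (@le_jump_sum _ _ _ _ _ LX _ _ _ _ _ _ m0) => //.
- by apply: null_below_le nf; rewrite ge_min lexx.
- by apply: null_below_le (steps_null _ _ k0 yd); rewrite ge_min lexx orbT.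
Qed.

Lemma steps_le_rate (I : Type) (s : seq I) (k y : I -> R) b delta f C :
  0 < delta -> 0 <= C -> (forall i, 0 <= k i) -> (forall i, delta <= y i) -> jump_test f ->
  (forall v, \sum_(i <- s) k i * above b (y i) v <= C * exp_defect f v) ->
  \sum_(i <- s) k i * above_rate b (y i) <= C * rate X f.
Proof.
move=> d0 C0 k0 yd tf H; have tg := exp_defect_test tf.
rewrite -lee_fin EFinM -[X in (_ <= _ * X)%E](rateE LX tf) -[X in (X <= _)%E](@integral_steps _ s k y b delta)//.
have [eta e0 [_ nf]] := jump_test_null tf.
rewrite -ge0_integralZl_EFin//; last 2 first.
- by move=> w _; rewrite lee_fin; exact: jump_sum_ge0.
- exact: measurable_exp_defect_sum.
apply: ge0_le_integral => //.
- move=> w _; rewrite lee_fin; apply: fine_ge0; apply: esum_ge0 => u _.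
  by rewrite lee_fin; apply: sumr_ge0 => i _; rewrite mulr_ge0// ler0n.
- exact: measurable_steps yd.
- by apply: emeasurable_funM => //; exact: measurable_exp_defect_sum.
move=> w _; rewrite -EFinM lee_fin.
have m0 : 0 < Num.min eta delta by rewrite lt_min e0.
have [r Hr] := jump_sum_repr LX w m0 (lexx 0) ltr01.
rewrite !Hr.
- by rewrite mulr_sumr; apply: ler_sum.
- by apply: null_below_le nf; rewrite ge_min lexx.
- by apply: null_below_le (steps_null _ _ k0 yd); rewrite ge_min lexx orbT.
Qed.

End Rates.

(** * Integral of a nonincreasing function over dyadic cells *)

Section DyadicIntegral.
Context {R : realType}.
Implicit Types y z : R.
Variables (G : R -> R) (f : R -> \bar R) (x : R).
Hypothesis x0 : 0 < x.
Hypothesis fG : forall y, 0 < y -> f y = (G y)%:E.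
Hypothesis G0 : forall y, 0 <= G y.
Hypothesis Gni : forall y z, 0 < y -> y <= z -> G z <= G y.

Let cell (i : nat) : set R := `]x / 2 ^+ i.+1, x / 2 ^+ i].

Let dyad_gt0 i : 0 < x / 2 ^+ i.
Proof. by rewrite divr_gt0// exprn_gt0. Qed.

Let dyadS i : x / 2 ^+ i = 2 * (x / 2 ^+ i.+1).
Proof. by rewrite exprS; field; rewrite expf_neq0. Qed.

Let le_dyad i j : (i <= j)%N -> x / 2 ^+ j <= x / 2 ^+ i.
Proof.
move=> ij; rewrite ler_pM2l// lef_pV2 ?posrE ?exprn_gt0//.
by rewrite ler_weXn2l// ler1n.
Qed.

Let bigcup_cell : \bigcup_i cell i = `]0, x]%classic.
Proof.
apply/seteqP; split => y /=.
  move=> [i _ /=]; rewrite !in_itv /= => /andP[iy yi]; rewrite !bnd_simp in iy yi.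
  apply/andP; split; first exact: lt_trans iy.
  by apply: le_trans yi _; have := le_dyad (leq0n i); rewrite expr0 divr1.
rewrite in_itv /= => /andP[y0 yx].
have ex : exists i, x / 2 ^+ i.+1 < y.
  have [n Hn] := filter_ex (near_mesh x y0); exists n.
  apply: le_lt_trans Hn; rewrite ler_pM2l// lef_pV2 ?posrE ?exprn_gt0// -natrX ler_nat.
  by rewrite ltnW// ltn_expl.
have [i iy mini] := ex_minnP ex.
exists i => //; rewrite /cell /= in_itv /= iy /=.
case: i iy mini => [|i] iy mini; first by rewrite expr0 divr1.
by rewrite leNgt; apply/negP => /mini; rewrite ltnn.
Qed.

Let trivIset_cell : trivIset setT cell.
Proof.
apply: ltn_trivIset => i j ji; apply/seteqP; split => // y [] /=.
rewrite /cell /= !in_itv /= => /andP[jy _] /andP[_ yi].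
by have := lt_le_trans jy yi; rewrite ltNge le_dyad.
Qed.

Let mcell i : measurable (cell i : set (measurableTypeR R)).
Proof. exact: measurable_itv. Qed.

(** The set where [G] is at least a given level is an interval. *)
Lemma measurable_nonincreasing : measurable_fun (`]0, x]%classic : set (measurableTypeR R)) f.
Proof.
apply: (@eq_measurable_fun _ _ _ _ _ (EFin \o G)).
  by move=> y; rewrite inE /= in_itv /= => /andP[y0 _]; rewrite fG.
apply/measurable_EFinP.
apply: (measurability (@RGenCInfty.G R)) => [|/= _ [_] [r] -> <-].
  exact: RGenCInfty.measurableE.
apply: is_interval_measurable => s t /=.
rewrite !in_itv /= !andbT => -[/andP[s0 _] Gs] [/andP[_ tx] Gt] u /andP[su ut].
rewrite !in_itv /= andbT (lt_le_trans s0 su) (le_trans ut tx); split => //.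
by rewrite (le_trans Gt)// Gni// (lt_le_trans s0 su).
Qed.

Let mf_cell i : measurable_fun (cell i) f.
Proof.
apply: measurable_funS measurable_nonincreasing; first exact: measurable_itv.
by rewrite -bigcup_cell; exact: bigcup_sup.
Qed.

Let cell_pos i y : cell i y -> 0 < y.
Proof. by rewrite /cell /= in_itv /= => /andP[+ _]; apply: lt_trans. Qed.

Let cell_measure i : lebesgue_measure (cell i) = (x / 2 ^+ i.+1)%:E.
Proof.
rewrite lebesgue_measure_itv /= lte_fin.
have -> : x / 2 ^+ i.+1 < x / 2 ^+ i by rewrite (dyadS i) ltr_pMl// ltr1n.
by rewrite -EFinB; congr EFin; rewrite (dyadS i); ring.
Qed.

Let f_ge0 i y : cell i y -> (0 <= f y)%E.
Proof. by move/cell_pos/fG ->; rewrite lee_fin. Qed.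

Let integral_cell_ge i :
  ((x / 2 ^+ i.+1 * G (x / 2 ^+ i))%:E <= \int[lebesgue_measure]_(y in cell i) f y)%E.
Proof.
have -> : ((x / 2 ^+ i.+1 * G (x / 2 ^+ i))%:E =
    \int[lebesgue_measure]_(y in cell i) (cst (G (x / 2 ^+ i))%:E y))%E.
  rewrite integral_cst// mulrC EFinM; congr (_ * _)%E.
  exact/esym/cell_measure.
apply: ge0_le_integral => //.
- by move=> y _; rewrite lee_fin.
- exact: mf_cell.
- move=> y cy; rewrite fG ?(cell_pos cy)// lee_fin Gni ?(cell_pos cy)//.
  by move: cy; rewrite /cell /= in_itv /= => /andP[].
Qed.

Let integral_cell_le i :
  (\int[lebesgue_measure]_(y in cell i) f y <= (x / 2 ^+ i.+1 * G (x / 2 ^+ i.+1))%:E)%E.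
Proof.
have -> : ((x / 2 ^+ i.+1 * G (x / 2 ^+ i.+1))%:E =
    \int[lebesgue_measure]_(y in cell i) (cst (G (x / 2 ^+ i.+1))%:E y))%E.
  rewrite integral_cst// mulrC EFinM; congr (_ * _)%E.
  exact/esym/cell_measure.
apply: ge0_le_integral => //.
- by move=> y /f_ge0.
- exact: mf_cell.
- move=> y cy; rewrite fG ?(cell_pos cy)// lee_fin Gni//.
  by move: cy; rewrite /cell /= in_itv /= => /andP[/ltW].
Qed.

Let integral_cells : (int_tail f x =
  \big[+%E/0]_(0 <= i <oo) \int[lebesgue_measure]_(y in cell i) f y)%E.
Proof.
rewrite /int_tail -bigcup_cell; apply: ge0_integral_bigcup => //.
- by rewrite bigcup_cell; exact: measurable_nonincreasing.
- by move=> y [i _ /f_ge0].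
Qed.

(** Each cell contributes at least its length times the value at its right end; the upper bound
    below uses the left end. *)
Lemma dyadic_sum_le_integral m :
  ((\sum_(i < m) x / 2 ^+ i.+1 * G (x / 2 ^+ i))%:E <= int_tail f x)%E.
Proof.
rewrite integral_cells; apply: le_trans (nneseries_lim_ge m _); last first.
  by move=> n _ _; apply: integral_ge0 => y /f_ge0.
by rewrite big_mkord -sumEFin; apply: lee_sum => i _; exact: integral_cell_ge.
Qed.

Lemma integral_le_dyadic_sum B :
  (forall m, \sum_(i < m) x / 2 ^+ i.+1 * G (x / 2 ^+ i.+1) <= B) ->
  (int_tail f x <= B%:E)%E.
Proof.
move=> HB; rewrite integral_cells; apply: lime_le.
  by apply: is_cvg_nneseries => i _ _; apply: integral_ge0 => y /f_ge0.
apply: nearW => m; apply: (@le_trans _ _ (\sum_(i < m) x / 2 ^+ i.+1 * G (x / 2 ^+ i.+1))%:E).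
  by rewrite big_mkord -sumEFin; apply: lee_sum => i _; exact: integral_cell_le.
by rewrite lee_fin.
Qed.

End DyadicIntegral.

(** * Tails of the Lévy measure as expected numbers of jumps *)

Section JumpTails.
Context d (T : measurableType d) (R : realType) (P : probability T R).
Variable X : R -> {RV P >-> R}.
Variable Pi : {measure set (measurableTypeR R) -> \bar R}.
Hypothesis LX : levy_process X.
Hypothesis X_Pi : levy_measure_of P X Pi.

Definition tail (b : bool) : R -> \bar R := if b then tail_pos Pi else tail_neg Pi.

Let beyond (b : bool) (y : R) : set (measurableTypeR R) :=
  if b then `]y, +oo[%classic else `]-oo, (- y)[%classic.

Let beyondE b y v : 0 < y -> beyond b y v <-> y < side b v.
Proof.
move=> y0; rewrite /beyond /side; case: b => /=; rewrite in_itv /= ?andbT lt_max (ltNge y 0) (ltW y0) orbF//.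
by rewrite ltrNr.
Qed.

(** The set is finite because all jumps larger than [y] occur at points of [C]. *)
Lemma counting_above b y w : 0 < y ->
  counting [set s | 0 < s <= 1 /\ beyond b y (jump X s w)] =
  (jump_sum X (above b y) 0 1 w)%:E.
Proof.
move=> y0; have cX := levy_cadlag LX w.
have [a0 ay] := above_null b y.
have le01 : 0 <= 0 + 1 :> R by rewrite add0r ler01.
have [C HC] := cadlag_almost_constant cX y0 (lexx 0) le01.
set A := [set s | _].
have AE : A = `]0, 0 + 1] `&` [set s | y < side b (jump X s w)].
  apply/seteqP; split => s; rewrite /A /= in_itv /= add0r.
    by move=> [s01 /beyondE-/(_ y0)].
  by move=> [s01 ys]; split => //; apply/beyondE.
have finA : finite_set A.
  apply: (@sub_finite_set _ _ [set` C]); last exact: finite_seq.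
  rewrite AE => s /= [+ ys]; rewrite in_itv /= => sI.
  apply/negP => /negP sC.
  have := le_trans (side_le b _) (path_jump_le cX HC (lexx 0) sI sC).
  by rewrite leNgt ys.
rewrite /jump_sum.
have -> : \esum_(u in `]0, 0 + 1]) (above b y (jump X u w))%:E = \esum_(u in A) 1%E.
  rewrite AE esum_mkcondr; apply: eq_esum => u _; rewrite /above.
  by case: ifPn => [/[!inE]/= ->//|/negP/[!inE]/= /negP/negbTE ->].
rewrite esum_fset// fsbig_finite//= sumEFin /=.
rewrite /counting asboolT//; congr EFin.
by rewrite -sum1_size natr_sum.
Qed.

Lemma tailE b y : 0 < y -> tail b y = above_count X b y.
Proof.
move=> y0; have [_ HPi] := X_Pi.
have -> : tail b y = Pi (beyond b y) by rewrite /tail /beyond; case: b.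
rewrite HPi.
- by apply: eq_integral => w _; exact: counting_above.
- by rewrite /beyond; case: b; exact: measurable_itv.
- by move/beyondE => /(_ y0); rewrite /side oppr0 if_same maxxx ltNge ltW.
Qed.

End JumpTails.

(** * Test functions approximating sums and suprema *)

Section Gauges.
Context {R : realType}.
Implicit Types (x v : R) (kd b : bool).

(* Continuous functions vanishing near 0 that increase with [k] to
   [side b v / x] if [kd], and to [+oo * 1_(x < side b v)] otherwise. *)
Definition gauge kd b x (k : nat) v : R :=
  if kd then Num.max (side b v - k.+1%:R^-1) 0 / x
  else k.+1%:R * Num.max (side b v - x) 0.

Lemma max0_sub_le0 (y z : R) : y <= z -> Num.max (y - z) 0 = 0.
Proof. by rewrite -subr_le0 => /max_idPr. Qed.

Lemma max0_sub_ge0 (y z : R) : z <= y -> Num.max (y - z) 0 = y - z.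
Proof. by rewrite -subr_ge0 => /max_idPl. Qed.

Lemma gauge_test kd b x k : 0 < x -> jump_test (gauge kd b x k).
Proof.
move=> x0; have cpos (z : R) : continuous (fun v => Num.max (side b v - z) 0).
  move=> v; apply: cvg_maxr; last exact: cvg_cst.
  by apply: cvgB; [exact: continuous_side|exact: cvg_cst].
have pos0 (z v : R) : 0 <= Num.max (side b v - z) 0 by rewrite le_max lexx orbT.
have vdelta (z v : R) : `|v| <= z -> Num.max (side b v - z) 0 = 0.
  by move=> /(le_trans (side_le b v))/max0_sub_le0.
rewrite /gauge; case: kd; split.
- by move=> v; apply: cvgM; [exact: cpos|exact: cvg_cst].
- by move=> v; rewrite divr_ge0// ltW.
- by exists k.+1%:R^-1 => // v /vdelta ->; rewrite mul0r.
- by move=> v; apply: cvgM; [exact: cvg_cst|exact: cpos].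
- by move=> v; rewrite mulr_ge0.
- by exists x => // v /vdelta ->; rewrite mulr0.
Qed.

Lemma gauge_ge0 kd b x k v : 0 < x -> 0 <= gauge kd b x k v.
Proof. by move=> /(gauge_test kd b k)[_ + _]; apply. Qed.

Lemma gauge_nd kd b x m n v : 0 < x -> (m <= n)%N ->
  gauge kd b x m v <= gauge kd b x n v.
Proof.
move=> x0 mn; rewrite /gauge; case: kd.
  rewrite ler_pM2r ?invr_gt0// ge_max !le_max lexx orbT andbT lerD2l lerN2.
  by rewrite lef_pV2 ?posrE// ler_nat ltnS mn.
by rewrite ler_wpM2r ?ler_nat// le_max lexx orbT.
Qed.

Lemma gauge_eq0 kd b x k v : 0 < x -> side b v = 0 -> gauge kd b x k v = 0.
Proof.
move=> x0 v0; rewrite /gauge v0; case: kd.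
  by rewrite max0_sub_le0 ?invr_ge0// mul0r.
by rewrite max0_sub_le0 ?ltW// mulr0.
Qed.

Lemma side_disjoint v : side true v = 0 \/ side false v = 0.
Proof.
have [v0|v0] := leP 0 v; [right|left]; rewrite /side; apply/max_idPr; first by rewrite oppr_le0.
exact: ltW.
Qed.

Lemma gauge_disjoint kd kd' b x y k v : 0 < x -> 0 < y ->
  gauge kd b x k v = 0 \/ gauge kd' (~~ b) y k v = 0.
Proof.
move=> x0 y0; case: b; have [v0|v0] := side_disjoint v.
- by left; apply: gauge_eq0.
- by right; apply: gauge_eq0.
- by right; apply: gauge_eq0.
- by left; apply: gauge_eq0.
Qed.

(** The powers of 1 / 2 below u sum to at most 2 u, and all of them to at most 1. The induction
    removes the first power and rescales u to 2 u. *)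
Lemma dyadic_steps_le m (u : R) : 0 <= u ->
  \sum_(i < m) 2^-1 ^+ i.+1 * (2^-1 ^+ i.+1 < u)%R%:R <= Num.min 1 (2 * u).
Proof.
elim: m u => [|m IH] u u0; first by rewrite big_ord0 le_min ler01 mulr_ge0.
rewrite big_ord_recl /= expr1.
have -> : \sum_(i < m) 2^-1 ^+ (bump 0 i).+1 * (2^-1 ^+ (bump 0 i).+1 < u)%R%:R =
    2^-1 * \sum_(i < m) 2^-1 ^+ i.+1 * (2^-1 ^+ i.+1 < 2 * u)%R%:R :> R.
  rewrite mulr_sumr; apply: eq_bigr => i _; rewrite /bump /= add1n exprS -mulrA.
  by congr (_ * (_ * _%:R)); rewrite mulrC ltr_pdivrMr// mulrC.
have /IH : 0 <= 2 * u by rewrite mulr_ge0.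
set S := \sum_(i < m) _.
rewrite !le_min => /andP[S1 S2].
by have [h|h] := ltP 2^-1 u; rewrite ?mulr1 ?mulr0; apply/andP; split; lra.
Qed.

End Gauges.

(** * Rates of gauges against tails and their integrals *)

Section GaugeRates.
Context d (T : measurableType d) (R : realType) (P : probability T R).
Variable X : R -> {RV P >-> R}.
Variable Pi : {measure set (measurableTypeR R) -> \bar R}.
Hypothesis LX : levy_process X.
Hypothesis X_Pi : levy_measure_of P X Pi.
Implicit Types (x B : R) (b kd : bool).

Lemma rate_gauge_nd kd b x m n : 0 < x -> (m <= n)%N ->
  rate X (gauge kd b x m) <= rate X (gauge kd b x n).
Proof.
by move=> x0 mn; apply: (le_rate LX) => [||v]; [exact: gauge_test|exact: gauge_test|
  exact: gauge_nd].
Qed.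

Lemma sup_rate_le b x k : 0 < x -> rate X (gauge false b x k) <= above_rate X b x.
Proof.
move=> x0.
have := @rate_le_steps _ _ _ _ _ LX unit [:: tt] (fun=> 1) (fun=> x) b x
  (gauge false b x k) x0 (fun=> ler01) (fun=> lexx x) (gauge_test _ _ _ x0).
rewrite !big_seq1 mul1r; apply => v; rewrite big_seq1 mul1r /above /exp_defect.
have [xv|vx] := ltP x (side b v); first by rewrite lerBlDr lerDl expR_ge0.
by rewrite /gauge max0_sub_le0// mulr0 oppr0 expR0 subrr.
Qed.

(** [above_approx b x k] is the minimum of 1 and the gauge, hence at most twice the defect;
    [above_sum_approx] lets k tend to infinity. *)
Lemma sup_rate_ge b x B : 0 < x -> (forall k, rate X (gauge false b x k) <= B) ->
  above_rate X b x <= 2 * B.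
Proof.
move=> x0 HB; rewrite -lee_fin -[X in (X <= _)%E](above_rateE LX)//.
have := @above_sum_approx _ _ _ _ _ LX b x x0.
rewrite -/(above_count X b x) => cv.
rewrite -(cvg_lim _ cv)//; apply: lime_le; first by apply/cvg_ex; eexists; exact: cv.
apply: nearW => k.
apply: (@le_trans _ _ (2 * rate X (gauge false b x k))%:E); last first.
  by rewrite lee_fin ler_pM2l.
have tf := gauge_test false b k x0.
rewrite EFinM -[X in (_ <= _ * X)%E](rateE LX tf) -ge0_integralZl_EFin//; last 2 first.
- by move=> w _; rewrite lee_fin; apply: jump_sum_ge0; exact: exp_defect_test.
- exact: measurable_exp_defect_sum.
have [delta d0 [_ nf]] := jump_test_null tf.
apply: ge0_le_integral => //.
- by move=> w _; rewrite lee_fin; apply: jump_sum_ge0; exact: above_approx_test.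
- apply/measurable_EFinP; apply: measurable_jump_sum => //; exact: above_approx_test.
- by apply: emeasurable_funM => //; exact: measurable_exp_defect_sum.
move=> w _; rewrite -EFinM lee_fin.
have md0 : 0 < Num.min x delta by rewrite lt_min x0.
have [s Hs] := jump_sum_repr LX w md0 (lexx 0) ltr01.
rewrite !Hs.
- rewrite mulr_sumr; apply: ler_sum => c _; rewrite /exp_defect.
  exact: (exp_defect_ge (gauge_ge0 false b k (jump X c w) x0)).
- by apply: null_below_le nf; rewrite ge_min lexx orbT.
- by apply: (null_below_le _ (above_approx_null b k x0)); rewrite ge_min lexx.
Qed.

Let tail_fin b y : 0 < y -> tail Pi b y = (above_rate X b y)%:E.
Proof. by move=> y0; rewrite (tailE LX X_Pi)// (above_rateE LX). Qed.

(** For a jump of size v, the defect of the gauge is at most min (1, v / x), hence at most 2 / 2^i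
    for the first i with x / 2^i < v. The dyadic lower bound of the integral has weights x / 2^(i +
    1), whence the constant 4. *)
Lemma sum_rate_le b x k : 0 < x ->
  ((x * rate X (gauge true b x k))%:E <= 4%:E * int_tail (tail Pi b) x)%E.
Proof.
move=> x0; set e : R := k.+1%:R^-1.
have e0 : 0 < e by rewrite invr_gt0.
(* The gauge vanishes for jumps up to [e], so finitely many thresholds are enough. *)
have [m Hm] : exists m, x / 2 ^+ m < e.
  have [n Hn] := filter_ex (near_mesh x e0); exists n.+1.
  apply: le_lt_trans Hn; rewrite ler_pM2l// lef_pV2 ?posrE ?exprn_gt0// -natrX ler_nat.
  by rewrite ltnW// ltn_expl.
have mono := @dyadic_sum_le_integral R (above_rate X b) (tail Pi b) x x0
  (tail_fin b) (above_rate_ge0 X b) (fun y z => @le_above_rate _ _ _ _ _ LX b y z) m.+1.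
have H4 : (0 <= 4%:E :> \bar R)%E by rewrite lee_fin.
apply: le_trans (lee_wpmul2l H4 mono); rewrite -EFinM lee_fin.
pose dl := x / 2 ^+ m.
have dl0 : 0 < dl by rewrite divr_gt0// exprn_gt0.
have := @rate_le_steps _ _ _ _ _ LX 'I_m.+1 (index_enum 'I_m.+1)
  (fun i => 2 * 2^-1 ^+ i) (fun i => x / 2 ^+ i) b dl (gauge true b x k) dl0 _ _
  (gauge_test _ _ _ x0).
have p2 (i : nat) : 0 < 2 ^+ i :> R by rewrite exprn_gt0.
move=> H; rewrite (@le_trans _ _ (x * \sum_(i < m.+1) 2 * 2^-1 ^+ i * above_rate X b (x / 2 ^+ i)))//.
  rewrite ler_pM2l//; apply: H.
  - by move=> i; rewrite mulr_ge0// exprn_ge0// invr_ge0.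
  - by move=> i; rewrite /dl ler_pM2l// lef_pV2 ?posrE// ler_weXn2l ?ler1n// -ltnS.
  - move=> v; have [vd|dv] := leP (side b v) e.
      rewrite {1}/exp_defect /gauge max0_sub_le0// mul0r oppr0 expR0 subrr.
      by apply: sumr_ge0 => i _; rewrite !mulr_ge0// exprn_ge0// invr_ge0.
    have ex : exists i, x / 2 ^+ i < side b v by exists m; exact: lt_trans Hm dv.
    have [i iv mini] := ex_minnP ex.
    have im : (i < m.+1)%N by rewrite ltnS mini// (lt_trans Hm dv).
    rewrite (bigD1 (Ordinal im))//= /above iv mulr1.
    apply: (@le_trans _ _ (2 * 2^-1 ^+ i)); last first.
      rewrite lerDl; apply: sumr_ge0 => j _.
      by rewrite !mulr_ge0// exprn_ge0// invr_ge0.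
    apply: le_trans (exp_defect_le _) _.
    case: i iv mini im => [|i] iv mini im.
      by rewrite expr0 ge_min mulr1 ler1n.
    rewrite ge_min; apply/orP; right.
    have vi : side b v <= x / 2 ^+ i.
      by rewrite leNgt; apply/negP => /mini; rewrite ltnn.
    rewrite /gauge (max0_sub_ge0 (ltW dv)) ler_pdivrMr//.
    apply: (@le_trans _ _ (side b v)); first by rewrite lerBlDr lerDl ltW.
    apply: le_trans vi _; rewrite exprS mulrA divff ?mul1r ?pnatr_eq0//.
    by rewrite exprVn mulrC.
rewrite mulr_sumr mulr_sumr; apply: ler_sum => i _.
rewrite exprVn exprS.
have p2i := p2 i; move: (2 ^+ i) p2i (above_rate _ _ _) => q q0 G.
by rewrite le_eqVlt; apply/orP; left; apply/eqP; field; rewrite gt_eqF.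
Qed.

(** For u = v / x, the steps are at most min (1, 2 u) <= 4 min (1, u / 2). For large k the gauge is
    at least u / 2 wherever the steps do not vanish, and [exp_defect_ge] costs a factor 2, whence
    8. *)
Lemma sum_rate_ge b x B : 0 < x -> (forall k, rate X (gauge true b x k) <= B) ->
  (int_tail (tail Pi b) x <= (8 * B * x)%:E)%E.
Proof.
move=> x0 HB; apply: (@integral_le_dyadic_sum R (above_rate X b) (tail Pi b) x x0
  (tail_fin b) (above_rate_ge0 X b) (fun y z => @le_above_rate _ _ _ _ _ LX b y z)) => m.
have p2 (i : nat) : 0 < 2 ^+ i :> R by rewrite exprn_gt0.
pose dl := x / 2 ^+ m.
have dl0 : 0 < dl by rewrite divr_gt0.
have dl20 : 0 < dl / 2 by rewrite divr_gt0.
(* The truncation 1 / (k + 1) of the gauge is less than half of [dl], the smallest threshold. *)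
have [k Hk] := filter_ex (near_mesh 1 dl20).
rewrite div1r in Hk.
have tf := gauge_test true b k x0.
have H := @steps_le_rate _ _ _ _ _ LX 'I_m (index_enum 'I_m)
  (fun i => 2^-1 ^+ i.+1) (fun i => x / 2 ^+ i.+1) b dl (gauge true b x k) 8 dl0 _ _ _ tf.
have {}H : \sum_(i < m) 2^-1 ^+ i.+1 * above_rate X b (x / 2 ^+ i.+1) <=
    8 * rate X (gauge true b x k).
  apply: H => //.
  - by move=> i; rewrite /dl ler_pM2l// lef_pV2 ?posrE// ler_weXn2l ?ler1n.
  move=> v; have g0 := gauge_ge0 true b k v x0.
  have [vd|dv] := leP (side b v) dl.
    rewrite big1; first by rewrite mulr_ge0//; case: (exp_defect_test tf).
    move=> i _; rewrite /above ltNge (le_trans vd) ?mulr0//.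
    by rewrite /dl ler_pM2l// lef_pV2 ?posrE// ler_weXn2l ?ler1n.
  have v0 : 0 < side b v by exact: lt_trans dv.
  have u0 : 0 <= side b v / x by rewrite divr_ge0// ltW.
  have := dyadic_steps_le m u0.
  have -> : \sum_(i < m) 2^-1 ^+ i.+1 * (2^-1 ^+ i.+1 < side b v / x)%R%:R =
      \sum_(i < m) 2^-1 ^+ i.+1 * above b (x / 2 ^+ i.+1) v.
    apply: eq_bigr => i _; rewrite /above ltr_pdivlMr// exprVn.
    by rewrite [_^-1 * x]mulrC.
  move=> /le_trans; apply.
  have := exp_defect_ge g0; rewrite -/(exp_defect (gauge true b x k) v).
  have : side b v / x / 2 <= gauge true b x k v.
    rewrite /gauge; move: Hk dv dl0; clear dl20; move: (k.+1%:R^-1) dl => e dl Hk dv dl0.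
    rewrite max0_sub_ge0; last by lra.
    rewrite mulrAC ler_pM2r ?invr_gt0//; lra.
  move: (side b v / x) (gauge true b x k v) (exp_defect _ _) u0 => u g E u0.
  have [h1|h1] := leP 1 g; have [h2|h2] := leP 1 (2 * u); lra.
rewrite (_ : \sum_(i < m) _ = x * \sum_(i < m) 2^-1 ^+ i.+1 * above_rate X b (x / 2 ^+ i.+1)).
  rewrite mulrC ler_pM2r//; apply: le_trans H _.
  by rewrite ler_pM2l.
by rewrite mulr_sumr; apply: eq_bigr => i _; rewrite exprVn mulrA.
Qed.

End GaugeRates.

(** * Sums and suprema of jumps *)

Section ExpCutoff.
Context {R : realType}.
Implicit Types (x r : R) (y : \bar R) (kd : bool).

(* [exp (- y / x)] if [kd], and the indicator of [y <= x] otherwise; both are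
   small exactly when [y] is large compared with [x]. *)
Definition cutoff kd x y : R :=
  if kd then (if y is r%:E then expR (- (r / x)) else 0) else (y <= x%:E)%E%:R.

Lemma cutoff_unit kd x y : 0 < x -> (0 <= y)%E -> 0 <= cutoff kd x y <= 1.
Proof.
move=> x0 y0; rewrite /cutoff; case: kd; last by case: (_ <= _)%E; rewrite /= ?lexx ?ler01.
case: y y0 => [r| |]; rewrite ?lee_fin ?lexx ?ler01// => r0.
by apply: expR_unit; rewrite divr_ge0// ltW.
Qed.

(** The level exp (- 1) suits both kinds; through it the event that [y] is at most [x] becomes
    measurable and obeys Markov's inequality. *)
Lemma cutoff_ge kd x y : 0 < x -> (0 <= y)%E ->
  (expR (- 1) <= cutoff kd x y) = (y <= x%:E)%E.
Proof.
move=> x0 y0; rewrite /cutoff; case: kd.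
  case: y y0 => [r| |] // y0; last by rewrite leNgt expR_gt0 leye_eq.
  by rewrite ler_expR lerN2 ler_pdivrMr// mul1r lee_fin.
case: (y <= _)%E => /=; last by rewrite leNgt expR_gt0.
by rewrite -[leRHS]expR0 ler_expR oppr_le0 ler01.
Qed.

(** The factor [expR 1] makes the right-hand side at least 1 where the indicator is 1, so that one
    bound covers both kinds. *)
Lemma cutoff_le kd x r : 0 < x -> 0 <= r ->
  cutoff kd x r%:E <= expR 1 * expR (- (r / x)).
Proof.
move=> x0 r0; rewrite /cutoff -expRD; case: kd.
  by rewrite ler_expR lerDr.
rewrite lee_fin; have [rx|xr] := leP r x; last exact: expR_ge0.
by rewrite -[leLHS]expR0 ler_expR subr_ge0 ler_pdivrMr// mul1r.
Qed.

Lemma cutoff_y kd x : cutoff kd x +oo%E = 0.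
Proof. by rewrite /cutoff; case: kd. Qed.

Lemma cutoff_defect_le kd x r : 0 < x -> 0 <= r -> 1 - cutoff kd x r%:E <= r / x.
Proof.
move=> x0 r0; rewrite /cutoff; case: kd.
  by rewrite lerBlDr addrC -lerBlDr; exact: expR_ge1Dx.
rewrite lee_fin; have [rx|xr] := leP r x; first by rewrite subrr divr_ge0// ltW.
by rewrite subr0 ler_pdivlMr// mul1r ltW.
Qed.

End ExpCutoff.

Section JumpExtent.
Context d (T : measurableType d) (R : realType) (P : probability T R).
Variable X : R -> {RV P >-> R}.
Hypothesis LX : levy_process X.
Implicit Types (x t : R) (kd b : bool).

Definition extent kd b t w : \bar R :=
  if kd then \esum_(s in `]0, t]) (side b (jump X s w))%:E
  else ereal_sup [set (side b (jump X s w))%:E | s in `]0, t]].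

Lemma extent_ge0 kd b t w : 0 < t -> (0 <= extent kd b t w)%E.
Proof.
move=> t0; rewrite /extent; case: kd.
  by apply: esum_ge0 => s _; rewrite lee_fin side_ge0.
apply: (@le_trans _ _ (side b (jump X t w))%:E); first by rewrite lee_fin side_ge0.
by apply: ereal_sup_ubound; exists t => //=; rewrite in_itv /= t0 lexx.
Qed.

Let excess b (e v : R) := Num.max (side b v - e) 0.

Let excess_test b e : 0 < e -> jump_test (excess b e).
Proof.
move=> e0; have := gauge_test false b 0 e0.
by rewrite (_ : gauge false b e 0 = excess b e)//; apply/funext => v; rewrite /gauge mul1r.
Qed.

(** The truncated jumps increase with k, and the limit is exchanged with the supremum over finite
    sets of times. *)
Lemma sum_excess_cvg b t w : 0 < t ->
  (jump_sum X (excess b k.+1%:R^-1) 0 t w)%:E @[k --> \oo] --> extent true b t w.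
Proof.
move=> t0; set p := fun k => _.
have e0 k : 0 < k.+1%:R^-1 :> R by rewrite invr_gt0.
have pE k : p k = \esum_(s in `]0, t]) (excess b k.+1%:R^-1 (jump X s w))%:E.
  by rewrite /p -(jump_sumE LX)// ?add0r//; exact: excess_test.
have ex_nd m n v : (m <= n)%N -> excess b m.+1%:R^-1 v <= excess b n.+1%:R^-1 v.
  move=> mn; rewrite /excess ge_max !le_max lexx orbT andbT lerD2l lerN2.
  by rewrite lef_pV2 ?posrE// ler_nat ltnS mn.
have ex_le k v : excess b k.+1%:R^-1 v <= side b v.
  by rewrite /excess ge_max side_ge0 andbT lerBlDr lerDl ltW.
have ex_cvg v : excess b k.+1%:R^-1 v @[k --> \oo] --> side b v.
  have -> : side b v = Num.max (side b v - 0) 0 by rewrite subr0; apply/esym/max_idPl/side_ge0.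
  apply: cvg_maxr; last exact: cvg_cst.
  by apply: cvgB; [exact: cvg_cst|exact: cvg_harmonic].
have nd : nondecreasing_seq p.
  by move=> m n mn; rewrite !pE; apply: le_esum => s _; rewrite lee_fin ex_nd.
rewrite (_ : extent true b t w = ereal_sup (range p)); first exact: ereal_nondecreasing_cvgn.
apply/eqP; rewrite eq_le; apply/andP; split.
  apply: ge_ereal_sup => _ [A [finA AI] <-].
  have cv : (\sum_(s <- finmap.enum_fset (fset_set A)) (excess b k.+1%:R^-1 (jump X s w))%:E)%E @[k --> \oo] -->
      (\sum_(s <- finmap.enum_fset (fset_set A)) (side b (jump X s w))%:E)%E.
    apply: cvg_nnesum => s _; first by near=> k; rewrite lee_fin le_max lexx orbT.
    by apply/fine_cvgP; split; [near=> k|exact: ex_cvg].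
  rewrite fsbig_finite//= -(cvg_lim _ cv)//.
  apply: lime_le; first by apply/cvg_ex; eexists; exact: cv.
  apply: nearW => k; apply: (@le_trans _ _ (p k)); last by apply: ereal_sup_ubound; exists k.
  by rewrite pE; apply: esum_ge; exists A => //; rewrite fsbig_finite.
apply: ge_ereal_sup => _ [k _ <-]; rewrite pE; apply: le_esum => s _.
by rewrite lee_fin.
Unshelve. all: by end_near. Qed.

(** For sums the exponent increases to Y / x, possibly infinite. For suprema the jump sum is k + 1
    times the total excess over x, which is 0 exactly when no jump exceeds x. *)
Lemma laplace_gauge_cvg kd b x t w : 0 < x -> 0 < t ->
  expR (- jump_sum X (gauge kd b x k) 0 t w) @[k --> \oo] -->
  cutoff kd x (extent kd b t w).
Proof.
move=> x0 t0; rewrite /cutoff; case: kd.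
  have e0 k : 0 < k.+1%:R^-1 :> R by rewrite invr_gt0.
  have -> : (fun k => expR (- jump_sum X (gauge true b x k) 0 t w)) =
      (fun k => expR (- (jump_sum X (excess b k.+1%:R^-1) 0 t w / x))).
    apply/funext => k; congr (expR (- _)).
    have [delta d0 [nf _]] := jump_test_null (excess_test b (e0 k)).
    have [s Hs] := jump_sum_repr LX w d0 (lexx 0) t0.
    rewrite !Hs//; first by rewrite mulr_suml.
    split=> [v|v vd]; first exact: gauge_ge0.
    by rewrite /gauge; case: nf => _ /(_ _ vd); rewrite /excess => ->; rewrite mul0r.
  have := @sum_excess_cvg b t w t0; have := @extent_ge0 true b t w t0.
  case: (extent _ _ _ _) => [r _ /fine_cvgP[_ cv]|_ /cvgeryP cv|//].
    apply: (@cvg_comp _ _ _ (fun k => - (jump_sum X (excess b k.+1%:R^-1) 0 t w / x)) expR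
      _ _ _ _ (@continuous_expR R _)).
    by apply: cvgN; apply: cvgM cv _; exact: cvg_cst.
  apply: (@cvg_comp _ _ _ (fun k => jump_sum X (excess b k.+1%:R^-1) 0 t w / x)
    (fun y => expR (- y)) _ _ _ _ (@cvgr_expR R)).
  apply/cvgryPge => A; move/cvgryPge : cv => /(_ (A * x)).
  by apply: filterS => k; rewrite ler_pdivlMr.
have tx := excess_test b x0.
have [delta d0 [nf _]] := jump_test_null tx.
have gE k : jump_sum X (gauge false b x k) 0 t w = k.+1%:R * jump_sum X (excess b x) 0 t w.
  have [s Hs] := jump_sum_repr LX w d0 (lexx 0) t0.
  rewrite !Hs//; first by rewrite mulr_sumr.
  split=> [v|v vd]; first exact: gauge_ge0.
  by rewrite /gauge; case: nf => _ /(_ _ vd); rewrite /excess => ->; rewrite mulr0.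
under eq_fun do rewrite gE.
have sE := jump_sumE LX w tx (lexx 0) t0; rewrite add0r in sE.
have s0 := jump_sum_ge0 X 0 t w tx.
have [ex|] := boolP (extent false b t w <= x%:E)%E.
  have -> : jump_sum X (excess b x) 0 t w = 0.
    apply: EFin_inj; rewrite -sE; apply: esum1 => u ut; congr EFin.
    apply: max0_sub_le0; rewrite -lee_fin; apply: le_trans ex.
    by apply: ereal_sup_ubound; exists u.
  by under eq_fun do rewrite mulr0 oppr0 expR0; exact: cvg_cst.
rewrite -ltNge => /ereal_sup_gt[_ [u ut <-]]; rewrite lte_fin => xu.
have sp : 0 < jump_sum X (excess b x) 0 t w.
  rewrite -lte_fin -sE; apply: (@lt_le_trans _ _ (excess b x (jump X u w))%:E).
    by rewrite lte_fin /excess lt_max subr_gt0 xu.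
  apply: esum_ge; exists [set u]; last by rewrite fsbig_set1.
  by split; [exact: finite_set1|move=> _ ->].
apply: (@cvg_comp _ _ _ (fun k => k.+1%:R * jump_sum X (excess b x) 0 t w)
    (fun y => expR (- y)) _ _ _ _ (@cvgr_expR R)).
apply/cvgryPge => A.
have := @near_mesh R A _ sp; apply: filterS => k.
by rewrite ltr_pdivrMr// mulrC => /ltW.
Qed.

Section CutoffMeans.
Variables (kd : bool) (b : bool) (x t : R).
Hypotheses (x0 : 0 < x) (t0 : 0 < t).

Let mgauge k : measurable_fun setT (fun w => expR (- jump_sum X (gauge kd b x k) 0 t w)).
Proof. by apply: (measurable_laplace LX) => //; exact: gauge_test. Qed.

Let gauge01 k w : 0 <= expR (- jump_sum X (gauge kd b x k) 0 t w) <= 1.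
Proof. by apply: laplace_unit; exact: gauge_test. Qed.

Lemma measurable_cutoff : measurable_fun setT (fun w => cutoff kd x (extent kd b t w)).
Proof.
by apply: (measurable_fun_cvg mgauge) => w _; exact: laplace_gauge_cvg.
Qed.

Lemma mean_cutoff r : rate X (gauge kd b x k) @[k --> \oo] --> r ->
  mean P (fun w => cutoff kd x (extent kd b t w)) = expR (- (t * r)).
Proof.
move=> cr.
have c1 : laplace X (gauge kd b x k) 0 t @[k --> \oo] -->
    mean P (fun w => cutoff kd x (extent kd b t w)).
  by apply: cvg_mean => // w; exact: laplace_gauge_cvg.
have c2 : laplace X (gauge kd b x k) 0 t @[k --> \oo] --> expR (- (t * r)).
  under eq_fun do rewrite (campbell LX (gauge_test kd b _ x0) t0).
  apply: (@cvg_comp _ _ _ (fun k => - (t * rate X (gauge kd b x k))) expR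
      _ _ _ _ (@continuous_expR R _)).
  by apply: cvgN; apply: cvgM cr; exact: cvg_cst.
exact: (cvg_unique _ c1 c2).
Qed.

End CutoffMeans.

(* Positive and negative jumps are independent: the two gauges have disjoint
   supports, so the rate of their sum is the sum of their rates. *)
Lemma mean_cutoffM kd kd' b x y t r s : 0 < x -> 0 < y -> 0 < t ->
  rate X (gauge kd b x k) @[k --> \oo] --> r ->
  rate X (gauge kd' (~~ b) y k) @[k --> \oo] --> s ->
  mean P (fun w => cutoff kd x (extent kd b t w) * cutoff kd' y (extent kd' (~~ b) t w)) =
  expR (- (t * r)) * expR (- (t * s)).
Proof.
move=> x0 y0 t0 cr cs.
pose f k v := gauge kd b x k v + gauge kd' (~~ b) y k v.
have tf k : jump_test (f k) /\
    rate X (f k) = rate X (gauge kd b x k) + rate X (gauge kd' (~~ b) y k).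
  apply: (rateD LX); [exact: gauge_test|exact: gauge_test|].
  by move=> v; exact: gauge_disjoint.
have fE k w : expR (- jump_sum X (f k) 0 t w) =
    expR (- jump_sum X (gauge kd b x k) 0 t w) *
    expR (- jump_sum X (gauge kd' (~~ b) y k) 0 t w).
  rewrite -expRD -opprD; congr (expR (- _)).
  have [delta d0 [nf ng _ _]] :=
    jump_test_null2 (gauge_test kd b k x0) (gauge_test kd' (~~ b) k y0).
  have [q Hq] := jump_sum_repr LX w d0 (lexx 0) t0.
  rewrite !Hq//; first by rewrite -big_split.
  split=> [v|v vd]; first by rewrite addr_ge0// gauge_ge0.
  by case: nf => _ nf; case: ng => _ ng; rewrite /f nf// ng// addr0.
have c1 : laplace X (f k) 0 t @[k --> \oo] -->
    mean P (fun w => cutoff kd x (extent kd b t w) * cutoff kd' y (extent kd' (~~ b) t w)).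
  apply: cvg_mean => [k|k w|w].
  - by apply: (measurable_laplace LX) => //; case: (tf k).
  - by apply: laplace_unit; case: (tf k).
  - by under eq_fun do rewrite fE; apply: cvgM; exact: laplace_gauge_cvg.
have c2 : laplace X (f k) 0 t @[k --> \oo] --> expR (- (t * (r + s))).
  have lE k : laplace X (f k) 0 t =
      expR (- (t * (rate X (gauge kd b x k) + rate X (gauge kd' (~~ b) y k)))).
    by case: (tf k) => tk <-; exact: campbell.
  under eq_fun do rewrite lE.
  apply: (@cvg_comp _ _ _
    (fun k => - (t * (rate X (gauge kd b x k) + rate X (gauge kd' (~~ b) y k)))) expR
      _ _ _ _ (@continuous_expR R _)).
  by apply: cvgN; apply: cvgM; [exact: cvg_cst|exact: cvgD].
by rewrite -expRD -opprD -mulrDr; exact: (cvg_unique _ c1 c2).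
Qed.

End JumpExtent.

(** * Convergence of the ratios *)

Section RatioCriterion.
Context d (T : measurableType d) (R : realType) (P : probability T R).
Variables (Yp Ym : R -> T -> \bar R) (kp km : bool) (psip psim : R -> R).
Implicit Types (x y t e : R).
Hypothesis Yp_ge0 : forall t w, 0 < t -> (0 <= Yp t w)%E.
Hypothesis Ym_ge0 : forall t w, 0 < t -> (0 <= Ym t w)%E.
Hypothesis mYp : forall x t, 0 < x -> 0 < t ->
  measurable_fun setT (fun w => cutoff kp x (Yp t w)).
Hypothesis mYm : forall x t, 0 < x -> 0 < t ->
  measurable_fun setT (fun w => cutoff km x (Ym t w)).
Hypothesis meanYp : forall x t, 0 < x -> 0 < t ->
  mean P (fun w => cutoff kp x (Yp t w)) = expR (- (t * psip x)).
Hypothesis meanYm : forall x t, 0 < x -> 0 < t ->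
  mean P (fun w => cutoff km x (Ym t w)) = expR (- (t * psim x)).
Hypothesis meanYpYm : forall x y t, 0 < x -> 0 < y -> 0 < t ->
  mean P (fun w => cutoff kp x (Yp t w) * cutoff km y (Ym t w)) =
  expR (- (t * psip x)) * expR (- (t * psim y)).
Hypothesis psip_ni : forall x y, 0 < x -> x <= y -> psip y <= psip x.
Hypothesis psim_ge0 : forall x, 0 < x -> 0 <= psim x.
Hypothesis psip_y : psip x @[x --> 0^'+] --> +oo.

(** The conventions u / 0 = +oo for u > 0, 0 / 0 = 0 and u / +oo = 0 all agree with an inequality
    between products. *)
Lemma ratio_gt (e : R) (u v : \bar R) : 0 < e -> (0 <= u)%E -> (0 <= v)%E ->
  (e%:E < `|u / v|)%E <-> exists2 r, v = r%:E & ((e * r)%:E < u)%E.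
Proof.
move=> e0 u0 v0.
have -> : (`|u / v| = u / v)%E by rewrite gee0_abs// mule_ge0// inve_ge0.
case: v v0 => [r| |] // r0; last first.
  rewrite invey mule0; split; last by case.
  by rewrite lte_fin ltNge ltW.
have [->|rn0] := eqVneq r 0.
  rewrite inve0; split.
    move: u0; rewrite le_eqVlt => /predU1P[<-|u0 _]; first by rewrite mul0e lte_fin ltNge ltW.
    by exists 0 => //; rewrite mulr0.
  by move=> [_ [<-]]; rewrite mulr0 => u_gt0; rewrite gt0_muley// ltry.
have {rn0}r_gt0 : 0 < r by rewrite lt_def rn0.
rewrite inver gt_eqF//; split.
  by move=> H; exists r => //; move: H; rewrite lte_pdivlMr// EFinM.
by move=> [_ [<-]]; rewrite lte_pdivlMr// EFinM.
Qed.

Let event e t := [set w | (e%:E < `|Ym t w / Yp t w|)%E].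

Let measurable_le kd (Y : R -> T -> \bar R) x t :
  (forall t w, 0 < t -> (0 <= Y t w)%E) ->
  (forall x t, 0 < x -> 0 < t -> measurable_fun setT (fun w => cutoff kd x (Y t w))) ->
  0 < x -> 0 < t -> measurable [set w | (Y t w <= x%:E)%E].
Proof.
move=> Y0 mY x0 t0.
have -> : [set w | (Y t w <= x%:E)%E] =
    (fun w => cutoff kd x (Y t w)) @^-1` `[expR (- 1), +oo[%classic.
  by apply/seteqP; split=> w /=; rewrite in_itv /= andbT (cutoff_ge kd x0 (Y0 t w t0)).
by rewrite -[X in measurable X]setTI; apply: mY => //; exact: measurable_itv.
Qed.

(** A rational between Yp and Ym / e turns the event into a countable union. *)
Let measurable_event e t : 0 < e -> 0 < t -> measurable (event e t).
Proof.
move=> e0 t0.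
pose F (q : rat) : set T := if 0 < ratr q :> R then
  [set w | (Yp t w <= (ratr q : R)%:E)%E] `&` ~` [set w | (Ym t w <= (e * ratr q)%:E)%E]
  else set0.
have -> : event e t = \bigcup_q F q.
  apply/seteqP; split=> w /=.
    move/(ratio_gt e0 (Ym_ge0 w t0) (Yp_ge0 w t0)) => [r rE].
    have r0 : 0 <= r by rewrite -lee_fin -rE Yp_ge0.
    move=> eu.
    have [s rs su] : exists2 s, r < s & ((e * s)%:E < Ym t w)%E.
      case: (Ym t w) eu => [m| |] //; last by exists (r + 1); [lra|exact: ltry].
      rewrite lte_fin => eu.
      have rm : r < m / e by rewrite ltr_pdivlMr// mulrC.
      exists ((r + m / e) / 2); first by move: (m / e) rm => z; lra.
      by rewrite lte_fin mulrC -ltr_pdivlMr//; move: (m / e) rm => z; lra.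
    have [q] := rat_in_itvoo rs; rewrite in_itv /= => /andP[rq qs].
    exists q => //; rewrite /F (le_lt_trans r0 rq); split => /=.
      by rewrite rE lee_fin ltW.
    apply/negP; rewrite -ltNge; apply: lt_trans su.
    by rewrite lte_fin ltr_pM2l.
  move=> [q _]; rewrite /F; case: ifP => // q0 [/= Yq /negP]; rewrite -ltNge => mq.
  apply/(ratio_gt e0 (Ym_ge0 w t0) (Yp_ge0 w t0)).
  case: (Yp t w) (Yp_ge0 w t0) Yq => [r| |] // r0; rewrite lee_fin => rq.
  by exists r => //; apply: le_lt_trans mq; rewrite lee_fin ler_pM2l.
apply: bigcupT_measurable_rat => q; rewrite /F; case: ifP => // q0.
apply: measurableI; first exact: (measurable_le Yp_ge0 mYp).
by apply: measurableC; apply: (measurable_le Ym_ge0 mYm) => //; rewrite mulr_gt0.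
Qed.

Definition prob (A : set T) : R := fine (P A).

Lemma probE A : measurable A -> P A = (prob A)%:E.
Proof. by move=> mA; rewrite /prob fineK// fin_num_measure. Qed.

Lemma prob_le_mean A (h : T -> R) (a : R) : measurable A -> measurable_fun setT h ->
  (forall w, 0 <= h w <= 1) -> 0 <= a -> (forall w, A w -> a <= h w) ->
  a * prob A <= mean P h.
Proof.
move=> mA mh h01 a0 Ah; rewrite -lee_fin EFinM -(meanE P mh h01) -probE//.
have -> : (a%:E * P A = \int[P]_w (a * \1_A w)%:E)%E.
  under eq_integral do rewrite EFinM.
  rewrite ge0_integralZl_EFin//.
  - by rewrite integral_indic// setIT.
  - exact/measurable_EFinP.
apply: ge0_le_integral => //.
- by move=> w _; rewrite lee_fin mulr_ge0.
- by apply/measurable_EFinP; exact: measurable_funM.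
- exact/measurable_EFinP.
move=> w _; rewrite lee_fin indicE; have [/[!inE] wA|_] := boolP (w \in A).
  by rewrite mulr1 Ah.
by rewrite mulr0; case/andP: (h01 w).
Qed.

Lemma mean_le_prob A (h : T -> R) (a : R) : measurable A -> measurable_fun setT h ->
  (forall w, 0 <= h w <= 1) -> 0 <= a -> (forall w, ~ A w -> h w <= a) ->
  mean P h <= prob A + a.
Proof.
move=> mA mh h01 a0 Ah; rewrite -lee_fin EFinD -(meanE P mh h01) -probE//.
have -> : (P A + a%:E = \int[P]_w (\1_A w + a)%:E)%E.
  under eq_integral do rewrite EFinD.
  rewrite ge0_integralD//.
  - by rewrite integral_indic// setIT integral_probability_cst.
  - exact/measurable_EFinP.
apply: ge0_le_integral => //.
- by move=> w _; rewrite lee_fin; case/andP: (h01 w).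
- exact/measurable_EFinP.
- by apply/measurable_EFinP; exact: measurable_funD.
move=> w _; rewrite lee_fin indicE; have [_|/negP] := boolP (w \in A).
  by have /andP[] := h01 w; rewrite /=; lra.
by rewrite inE => /Ah; rewrite /= add0r.
Qed.

Let prob_Yp_le y t : 0 < y -> 0 < t ->
  prob [set w | (Yp t w <= y%:E)%E] <= expR 1 * expR (- (t * psip y)).
Proof.
move=> y0 t0; rewrite -meanYp// -ler_pdivrMl ?expR_gt0// -expRN.
apply: prob_le_mean => //.
- exact: (measurable_le Yp_ge0 mYp).
- exact: mYp.
- by move=> w; apply: cutoff_unit => //; exact: Yp_ge0.
- by move=> w /=; rewrite (cutoff_ge kp y0 (Yp_ge0 w t0)).
Qed.

(** Lower bound of 1 - cutoff where the cutoff is below the level of [cutoff_ge]. *)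
Let c : R := 1 - expR (- 1).

Let c0 : 0 < c.
Proof. by rewrite /c subr_gt0 -[ltRHS]expR0 ltr_expR oppr_lt0. Qed.

Let prob_Ym_gt y t : 0 < y -> 0 < t ->
  c * prob (~` [set w | (Ym t w <= y%:E)%E]) <= t * psim y.
Proof.
move=> y0 t0.
have m01 w : 0 <= cutoff km y (Ym t w) <= 1 by apply: cutoff_unit => //; exact: Ym_ge0.
apply: (@le_trans _ _ (1 - expR (- (t * psim y)))); last first.
  by have := @expR_ge1Dx R (- (t * psim y)); lra.
rewrite -meanYm// -mean_sub1//; last exact: mYm.
apply: prob_le_mean => //.
- by apply: measurableC; exact: (measurable_le Ym_ge0 mYm).
- by apply: measurable_funB => //; exact: mYm.
- by move=> w; have := m01 w; lra.
- exact: ltW.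
- move=> w /= /negP; rewrite -(cutoff_ge km y0 (Ym_ge0 w t0)) -ltNge /c => h.
  by rewrite lerD2l lerN2 ltW.
Qed.

(** Union bound: if Ym > e Yp, then Yp <= y or Ym > e y. *)
Let prob_event_le e y t : 0 < e -> 0 < y -> 0 < t ->
  c * prob (event e t) <= c * (expR 1 * expR (- (t * psip y))) + t * psim (e * y).
Proof.
move=> e0 y0 t0; have ey0 : 0 < e * y by rewrite mulr_gt0.
have mA := measurable_le Yp_ge0 mYp y0 t0.
have mB : measurable (~` [set w | (Ym t w <= (e * y)%:E)%E]).
  by apply: measurableC; exact: (measurable_le Ym_ge0 mYm).
apply: le_trans (lerD (ler_wpM2l (ltW c0) (prob_Yp_le y0 t0)) (prob_Ym_gt ey0 t0)).
rewrite -mulrDr ler_pM2l// -lee_fin EFinD -!probE//; last exact: measurable_event.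
apply: le_trans (measureU2 _ mA mB).
apply: le_measure; rewrite ?inE; [exact: measurable_event|exact: measurableU|].
move=> w /= /(ratio_gt e0 (Ym_ge0 w t0) (Yp_ge0 w t0)) [r -> er].
have [ry|yr] := leP r y; [left|right]; first by rewrite lee_fin.
apply/negP; rewrite -ltNge; apply: lt_trans er.
by rewrite lte_fin ltr_pM2l.
Qed.

(** Off the event, either Yp is infinite and its cutoff is 0, or Ym <= e' Yp and the bounds
    [cutoff_le] and [cutoff_defect_le] multiply to u exp (1 - u) e' / e for u = Yp / x. *)
Let mean_le_event e e' x t : 0 < e -> 0 < e' -> 0 < x -> 0 < t ->
  mean P (fun w => cutoff kp x (Yp t w) * (1 - cutoff km (e * x) (Ym t w))) <=
  prob (event e' t) + e' / e.
Proof.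
move=> e0 e'0 x0 t0; have ex0 : 0 < e * x by rewrite mulr_gt0.
have p01 w : 0 <= cutoff kp x (Yp t w) <= 1 by apply: cutoff_unit => //; exact: Yp_ge0.
have m01 w : 0 <= cutoff km (e * x) (Ym t w) <= 1 by apply: cutoff_unit => //; exact: Ym_ge0.
apply: mean_le_prob.
- exact: measurable_event.
- by apply: measurable_funM; [exact: mYp|apply: measurable_funB => //; exact: mYm].
- by move=> w; have := p01 w; have := m01 w; nra.
- by rewrite divr_ge0// ltW.
move=> w; rewrite /event /=; move: (p01 w) (m01 w).
case: (Yp t w) (Yp_ge0 w t0) (ratio_gt e'0 (Ym_ge0 w t0) (Yp_ge0 w t0)) => [r| |] //; last first.
  by rewrite cutoff_y mul0r divr_ge0// ltW.
rewrite lee_fin => r0 [_ H] p01w m01w nev.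
have {H nev} : (Ym t w <= (e' * r)%:E)%E.
  by rewrite leNgt; apply/negP => er; apply: nev; apply/H; exists r.
case: (Ym t w) (Ym_ge0 w t0) m01w => [m| |] //; rewrite !lee_fin => m0 m01w mr.
have a := cutoff_le kp x0 r0; have b := cutoff_defect_le km ex0 m0.
pose u := r / x; have u0 : 0 <= u by rewrite divr_ge0// ltW.
have uexp : u * (expR 1 * expR (- u)) <= 1.
  rewrite -expRD; have h := @expR_ge1Dx R (u - 1).
  have : expR (u - 1) * expR (1 - u) = 1 by rewrite -expRD addrC subrKA subrr expR0.
  have := expR_ge0 (1 - u); nra.
apply: (@le_trans _ _ (expR 1 * expR (- u) * (e' / e * u))).
  apply: ler_pM => //; [by case/andP: p01w|by case/andP: m01w; lra|].
  apply: le_trans b _; rewrite ler_pdivrMr// /u.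
  have -> : e' / e * (r / x) * (e * x) = e' * r by field; rewrite !gt_eqF.
  by [].
have ee0 : 0 <= e' / e by rewrite divr_ge0// ltW.
have h := ler_wpM2l ee0 uexp; rewrite mulr1 in h.
apply: le_trans h; rewrite le_eqVlt; apply/orP; left; apply/eqP.
ring.
Qed.

Lemma cvg_ratio_sufficient :
  (forall e, 0 < e -> psim (e * x) / psip x @[x --> 0^'+] --> 0) ->
  cvg_in_probability_0 P (fun t w => (Ym t w / Yp t w)%E).
Proof.
move=> C e e0.
have fin : \forall t \near 0^'+, P (event e t) \is a fin_num.
  near=> t; have t0 : 0 < t by near: t; exact: nbhs_right_gt.
  by apply: fin_num_measure; exact: measurable_event.
apply/fine_cvgP; split; first exact: fin.
apply/cvgr0Pnorm_lt => eta eta0.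
pose A := eta / 2.
have A0 : 0 < A by rewrite divr_gt0.
(* lam = exp 1 / A works since lam exp (- lam) < 1. *)
have [lam lam0 Hlam] : exists2 lam, 0 < lam & expR 1 * expR (- lam) < A.
  have h : 0 < expR 1 / A by rewrite divr_gt0// expR_gt0.
  exists (expR 1 / A) => //.
  have e1 := expR_gt0 (1 : R).
  have := @expR_gt1Dx R (expR 1 / A) (lt0r_neq0 h).
  have := expR_gt0 (- (expR 1 / A)).
  have : expR (expR 1 / A) * expR (- (expR 1 / A)) = 1 by rewrite -expRD subrr expR0.
  have : expR 1 / A * A = expR 1 by rewrite divfK// gt_eqF.
  set z := expR 1 / A; clearbody z; move: (expR (- z)) (expR z) => p q zA qp p0 qz.
  have h1 : 0 < p * (q - (1 + z)) by apply: mulr_gt0 => //; lra.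
  have zp : z * p < 1 by lra.
  have : 0 < A * (1 - z * p) by apply: mulr_gt0 => //; lra.
  by rewrite -zA; lra.
have e20 : 0 < e / 2 by rewrite divr_gt0.
(* Chosen so that t psip (2 y) <= lam bounds t psim (e y) by c A. *)
pose k := c * A / lam.
have k0 : 0 < k by rewrite divr_gt0// mulr_gt0.
have /cvgr0Pnorm_lt/(_ k k0) := C _ e20.
have psip1 : \forall x \near 0^'+, 1 <= psip x by move/cvgryPge : psip_y; exact.
move=> /(filterI psip1) [r /= r0 Hr].
have {}Hr x : 0 < x -> x < r -> 1 <= psip x /\ psim (e / 2 * x) <= k * psip x.
  move=> x0 xr; have [|p1 pk] := Hr x _ x0.
    by rewrite /= sub0r normrN gtr0_norm.
  split=> //; have pp : 0 < psip x by exact: lt_le_trans p1.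
  by rewrite -ler_pdivrMr//; apply: le_trans (ltW pk); exact: ler_norm.
have r20 : 0 < r / 2 by rewrite divr_gt0.
have p0 : 0 < psip (r / 2) by have [] := Hr _ r20 (ltac:(lra)); lra.
near=> t.
have t0 : 0 < t by near: t; exact: nbhs_right_gt.
(* For such small t the dyadic search below does not stop at its first point. *)
have tl : t * psip (r / 2) <= lam.
  rewrite -ler_pdivlMr//; apply: ltW; near: t; apply: nbhs_right_lt.
  by rewrite divr_gt0.
(* [psip] need not attain the level lam / t, so y is the first of the points r / 2 / 2^n where it
   exceeds this level; the preceding point is 2 y, which is why the hypothesis was used with e /
   2. *)
have [y [y0 yr yl ly]] : exists y, [/\ 0 < y, 2 * y < r, lam < t * psip y & t * psip (2 * y) <= lam].
  pose z n := r / 2 / 2 ^+ n.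
  have z0 n : 0 < z n by rewrite divr_gt0// exprn_gt0.
  have ex : exists n, lam < t * psip (z n).
    have : \forall x \near 0^'+, lam / t + 1 <= psip x by move/cvgryPge : psip_y; exact.
    move=> [s /= s0 Hs].
    have [n Hn] := filter_ex (near_mesh (r / 2) s0).
    exists n.+1; rewrite mulrC -ltr_pdivrMr//.
    have zs : z n.+1 < s.
      apply: le_lt_trans Hn; rewrite ler_pM2l// lef_pV2 ?posrE ?exprn_gt0// -natrX ler_nat.
      by rewrite ltnW// ltn_expl.
    have : lam / t + 1 <= psip (z n.+1).
      by apply: Hs => //=; rewrite sub0r normrN gtr0_norm.
    by move: (lam / t) => q; lra.
  have [n Hn mini] := ex_minnP ex.
  case: n Hn mini => [|n] Hn mini.
    by move: Hn; rewrite /z expr0 divr1 ltNge tl.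
  have zS : 2 * z n.+1 = z n by rewrite /z exprS; field; rewrite expf_neq0.
  exists (z n.+1); split=> //; rewrite zS.
    apply: (@le_lt_trans _ _ (r / 2)); last by lra.
    rewrite /z ler_pdivrMr ?exprn_gt0//; apply: ler_peMr; first exact: ltW.
    by apply: exprn_ege1; rewrite ler1n.
  by rewrite leNgt; apply/negP => /mini; rewrite ltnn.
have y20 : 0 < 2 * y by rewrite mulr_gt0.
have [p1 pk] := Hr _ y20 yr.
rewrite -/(event e t) -/(prob (event e t)) ger0_norm ?fine_ge0//.
rewrite -(ltr_pM2l c0); apply: le_lt_trans (prob_event_le e0 y0 t0) _.
have -> : e * y = e / 2 * (2 * y) by field.
have a1 : expR 1 * expR (- (t * psip y)) < A.
  apply: le_lt_trans Hlam; rewrite ler_pM2l ?expR_gt0// ler_expR lerN2 ltW//.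
have a2 : t * psim (e / 2 * (2 * y)) <= c * A.
  apply: (@le_trans _ _ (k * lam)); last by rewrite /k divfK// gt_eqF.
  apply: (@le_trans _ _ (k * (t * psip (2 * y)))); last by rewrite ler_pM2l.
  by rewrite [leRHS]mulrCA ler_pM2l.
have -> : c * eta = c * A + c * A by rewrite /A; field.
by apply: ltr_leD => //; rewrite ltr_pM2l.
Unshelve. all: by end_near. Qed.

Lemma cvg_ratio_necessary :
  cvg_in_probability_0 P (fun t w => (Ym t w / Yp t w)%E) ->
  forall e, 0 < e -> psim (e * x) / psip x @[x --> 0^'+] --> 0.
Proof.
move=> C e e0; apply/cvgr0Pnorm_lt => k k0.
(* The mean bounded in [mean_le_event] would equal theta, at t = 1 / psip x, if the ratio of
   exponents were k; [e'] is chosen to have e' / e = theta / 2. *)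
pose theta := expR (- 1) * (1 - expR (- k)).
have theta0 : 0 < theta.
  by rewrite mulr_gt0 ?expR_gt0// subr_gt0 -[ltRHS]expR0 ltr_expR oppr_lt0.
pose e' := e * theta / 2.
have e'0 : 0 < e' by rewrite divr_gt0// mulr_gt0.
have t20 : 0 < theta / 2 by rewrite divr_gt0.
have := C e' e'0; move/fine_cvgP => [_ /cvgr0Pnorm_lt/(_ _ t20)].
move=> [tau /= tau0 Htau].
(* Makes t = 1 / psip x less than [tau]. *)
have big : \forall x \near 0^'+, tau^-1 + 1 <= psip x by move/cvgryPge : psip_y; exact.
near=> x.
have x0 : 0 < x by near: x; exact: nbhs_right_gt.
have px : tau^-1 + 1 <= psip x by near: x.
have taui0 : 0 < tau^-1 by rewrite invr_gt0.
have p0 : 0 < psip x by move: px; move: (tau^-1) taui0 => z; lra.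
have ex0 : 0 < e * x by rewrite mulr_gt0.
pose t := (psip x)^-1.
have t0 : 0 < t by rewrite invr_gt0.
have tt : t < tau.
  rewrite /t -[tau]invrK ltf_pV2 ?posrE//; move: px; move: (tau^-1) => z; lra.
have pt : prob (event e' t) < theta / 2.
  have := Htau t; rewrite /= sub0r normrN gtr0_norm// => /(_ tt t0).
  by rewrite ger0_norm// fine_ge0.
have := mean_le_event e0 e'0 x0 t0.
have -> : mean P (fun w => cutoff kp x (Yp t w) * (1 - cutoff km (e * x) (Ym t w))) =
    expR (- 1) * (1 - expR (- (t * psim (e * x)))).
  have tp : t * psip x = 1 by rewrite /t mulVf// gt_eqF.
  have p01 w : 0 <= cutoff kp x (Yp t w) <= 1 by apply: cutoff_unit => //; exact: Yp_ge0.
  have m01 w : 0 <= cutoff km (e * x) (Ym t w) <= 1 by apply: cutoff_unit => //; exact: Ym_ge0.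
  transitivity (mean P (fun w => cutoff kp x (Yp t w) -
      cutoff kp x (Yp t w) * cutoff km (e * x) (Ym t w))).
    by congr mean; apply/funext => w; rewrite mulrBr mulr1.
  rewrite meanB.
  - by rewrite meanYp// meanYpYm// tp mulrBr mulr1.
  - exact: mYp.
  - by apply: measurable_funM; [exact: mYp|exact: mYm].
  - by move=> w; have := p01 w; have := m01 w; nra.
  - by move=> w; case/andP: (p01 w).
have -> : e' / e = theta / 2 by rewrite /e'; field; rewrite gt_eqF.
have tE : t * psim (e * x) = psim (e * x) / psip x by rewrite /t mulrC.
rewrite tE ger0_norm; last by rewrite divr_ge0 ?psim_ge0// ltW.
move=> H; have {H pt} : expR (- 1) * (1 - expR (- (psim (e * x) / psip x))) < theta.
  apply: le_lt_trans H _; move: pt; set v := prob _; lra.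
by rewrite /theta ltr_pM2l ?expR_gt0// ltrD2l ltrN2 ltr_expR ltrN2.
Unshelve. all: by end_near. Qed.

End RatioCriterion.

Lemma cvg0_dominated (R : realType) (F : set_system R) (FF : Filter F) (u v : R -> R) (C : R) :
  (\forall x \near F, 0 <= u x <= C * v x) -> v @ F --> 0 -> u @ F --> 0.
Proof.
move=> uv v0; apply: (@squeeze_cvgr _ F FF R (fun=> 0) (fun x => C * v x) u uv 0 (cvg_cst 0)).
by rewrite -[X in _ --> X](mulr0 C); apply: cvgM v0; exact: cvg_cst.
Qed.

Lemma eq_cvg0 (R : realType) (F : set_system R) (u v : R -> R) :
  u =1 v -> u @ F --> 0 -> v @ F --> 0.
Proof. by move=> /funext ->. Qed.

Lemma cvg_EFin_near (R : realType) (F : set_system R) (FF : Filter F)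
    (f : R -> \bar R) (g : R -> R) :
  (\forall x \near F, f x = (g x)%:E) -> f @ F --> 0%E <-> g @ F --> 0.
Proof.
move=> fg; split.
  move/fine_cvgP => [_]; apply: cvg_trans; apply: near_eq_cvg.
  by move: fg; apply: filterS => x /= ->.
move=> g0; apply/fine_cvgP; split; first by move: fg; apply: filterS => x ->.
move: g0; apply: cvg_trans; apply: near_eq_cvg.
by move: fg; apply: filterS => x /= ->.
Qed.

(** * Exponents of sums and suprema compared with tails *)

Section Exponents.
Context d (T : measurableType d) (R : realType) (P : probability T R).
Variable X : R -> {RV P >-> R}.
Variable Pi : {measure set (measurableTypeR R) -> \bar R}.
Hypothesis LX : levy_process X.
Hypothesis X_Pi : levy_measure_of P X Pi.
Implicit Types (x e : R) (b kd : bool).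

(* Vacuous for suprema: only sums can be infinite. *)
Definition tame kd b : Prop :=
  kd -> {ae P, forall w, (extent X true b 1 w < +oo)%E}.

(* Sealed for the same reason as [rate]. *)
Lemma exponent_subdef kd b x : {r : R | r = limn (fun k => rate X (gauge kd b x k))}.
Proof. by eexists. Qed.

Definition exponent kd b x : R := sval (exponent_subdef kd b x).

Let exponentE kd b x : exponent kd b x = limn (fun k => rate X (gauge kd b x k)).
Proof. exact: (svalP (exponent_subdef kd b x)). Qed.

Let rate_nd kd b x : 0 < x -> nondecreasing_seq (fun k => rate X (gauge kd b x k)).
Proof. by move=> x0 m n; exact: (rate_gauge_nd LX). Qed.

(** The rates increase with k. For suprema the tail bounds them; for sums they tend to - ln (E exp
    (- Y(1) / x)), a finite number since Y(1) is almost surely finite. *)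
Lemma exponent_cvg kd b x : tame kd b -> 0 < x ->
  rate X (gauge kd b x k) @[k --> \oo] --> exponent kd b x.
Proof.
move=> H x0; rewrite exponentE; have nd := @rate_nd kd b x x0; move: H nd; case: kd => [/(_ isT) fin|_] nd; last first.
  apply: nondecreasing_is_cvgn => //; exists (above_rate X b x) => _ [k _ <-].
  exact: (sup_rate_le LX).
pose m := mean P (fun w => cutoff true x (extent X true b 1 w)).
have m0 : 0 < m.
  apply: mean_gt0.
  - exact: (measurable_cutoff LX).
  - by move=> w; apply: cutoff_unit => //; exact: extent_ge0.
  - move=> ae0; have : ~ {ae P, forall w : T, False} by apply: not_ae_false => w [].
    apply.
    apply: (filterS _ (filterI fin ae0)) => w []; rewrite /cutoff.
    have := @extent_ge0 _ _ _ _ X true b 1 w ltr01.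
    by case: (extent _ _ _ _ _) => [r _ _ /eqP|//|//]; rewrite gt_eqF// expR_gt0.
have c1 : laplace X (gauge true b x k) 0 1 @[k --> \oo] --> m.
  apply: cvg_mean.
  - by move=> k; apply: (measurable_laplace LX) => //; exact: gauge_test.
  - by move=> k w; apply: laplace_unit; exact: gauge_test.
  - by move=> w; exact: (laplace_gauge_cvg LX).
suff c2 : rate X (gauge true b x k) @[k --> \oo] --> - ln m.
  by apply/cvg_ex; exists (- ln m).
have rE k : rate X (gauge true b x k) = - ln (laplace X (gauge true b x k) 0 1).
  by rewrite (campbell LX (gauge_test true b k x0) ltr01) expRK mul1r opprK.
under eq_fun do rewrite rE.
apply: cvgN; apply: (@cvg_comp _ _ _ (fun k => laplace X (gauge true b x k) 0 1) (@ln R)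
  _ _ _ c1).
exact: continuous_ln.
Qed.

Let rate_le_exponent kd b x k : tame kd b -> 0 < x ->
  rate X (gauge kd b x k) <= exponent kd b x.
Proof.
move=> H x0; rewrite exponentE; apply: nondecreasing_cvgn_le; first exact: rate_nd.
by apply/cvg_ex; exists (exponent kd b x); exact: exponent_cvg.
Qed.

Let exponent_le kd b x B : tame kd b -> 0 < x ->
  (forall k, rate X (gauge kd b x k) <= B) -> exponent kd b x <= B.
Proof.
move=> H x0 HB; rewrite exponentE; apply: limr_le; last by near=> k.
by apply/cvg_ex; exists (exponent kd b x); exact: exponent_cvg.
Unshelve. all: by end_near. Qed.

Lemma exponent_ge0 kd b x : tame kd b -> 0 < x -> 0 <= exponent kd b x.
Proof.
move=> H x0; apply: le_trans (rate_le_exponent 0 H x0).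
by apply: rate_ge0; exact: gauge_test.
Qed.

Lemma exponent_ni kd b x y : tame kd b -> 0 < x -> x <= y ->
  exponent kd b y <= exponent kd b x.
Proof.
move=> H x0 xy; have y0 := lt_le_trans x0 xy.
apply: exponent_le => // k; apply: le_trans (rate_le_exponent k H x0).
apply: (le_rate LX) => [||v]; [exact: gauge_test|exact: gauge_test|].
rewrite /gauge; case: kd {H}.
  by rewrite ler_wpM2l ?lef_pV2 ?posrE// le_max lexx orbT.
rewrite ler_wpM2l// ge_max !le_max lexx orbT andbT lerD2l lerN2.
by rewrite xy.
Qed.

Let tail_fin b y : 0 < y -> tail Pi b y = (above_rate X b y)%:E.
Proof. by move=> y0; rewrite (tailE LX X_Pi)// (above_rateE LX). Qed.

Definition mean_tail b x : R := fine (int_tail (tail Pi b) x) / x.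

Lemma int_tail_fin b x : tame true b -> 0 < x ->
  int_tail (tail Pi b) x = (x * mean_tail b x)%:E.
Proof.
move=> H x0; rewrite /mean_tail mulrC divfK ?gt_eqF// fineK// ge0_fin_numE.
  have H8 := sum_rate_ge LX X_Pi x0 (fun k => rate_le_exponent k H x0).
  by rewrite (le_lt_trans H8)// ltry.
by apply: integral_ge0 => y /=; rewrite in_itv /= => /andP[y0 _]; rewrite tail_fin// lee_fin above_rate_ge0.
Qed.

(** The tail quantity equivalent to the exponent, with constants 4 and 8 in the next two lemmas. *)
Definition scale kd b x : R := if kd then mean_tail b x else above_rate X b x.

Lemma exponent_le_scale kd b x : tame kd b -> 0 < x ->
  exponent kd b x <= 4 * scale kd b x.
Proof.
move=> H x0; apply: exponent_le => // k; move: H; rewrite /scale; case: kd => H.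
  have := sum_rate_le LX X_Pi b k x0; rewrite int_tail_fin// -EFinM lee_fin.
  by rewrite mulrCA ler_pM2l.
apply: le_trans (sup_rate_le LX b k x0) _.
by rewrite ler_peMl ?above_rate_ge0// ler1n.
Qed.

Lemma scale_le_exponent kd b x : tame kd b -> 0 < x ->
  scale kd b x <= 8 * exponent kd b x.
Proof.
move=> H x0; have e0 := exponent_ge0 H x0; have re k := rate_le_exponent k H x0.
move: H e0 re; rewrite /scale; case: kd => H e0 re.
  have := sum_rate_ge LX X_Pi x0 re; rewrite int_tail_fin// lee_fin.
  by rewrite mulrC ler_pM2r.
apply: le_trans (sup_rate_ge LX x0 re) _.
by rewrite ler_wpM2r// ler_nat.
Qed.

(** x times [mean_tail b x] is an integral over ]0, x], hence increasing in x, so passing to e x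
    costs at most 1 / e; the factors 4 and 8 go from exponents to scales and back. *)
Lemma exponent_scale b x e : tame true b -> 0 < x -> 0 < e -> e <= 1 ->
  exponent true b (e * x) <= 32 / e * exponent true b x.
Proof.
move=> H x0 e0 e1; have ex0 : 0 < e * x by rewrite mulr_gt0.
apply: le_trans (exponent_le_scale H ex0) _.
have s8 := scale_le_exponent H x0; rewrite /= in s8.
have le_I : e * x * mean_tail b (e * x) <= x * mean_tail b x.
  rewrite -lee_fin -!int_tail_fin//.
  have exx : e * x <= x by rewrite ler_piMl// ltW.
  have mt := @measurable_nonincreasing R (above_rate X b) (tail Pi b) x
    (tail_fin b) (fun y z => @le_above_rate _ _ _ _ _ LX b y z).
  apply: (@ge0_subset_integral _ (measurableTypeR R) R lebesgue_measure
    `]0, e * x]%classic `]0, x]%classic (measurable_itv _) (measurable_itv _) _ mt).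
    by move=> y /=; rewrite in_itv /= => /andP[y0 _]; rewrite tail_fin// lee_fin above_rate_ge0.
  by apply: subset_itvl; rewrite bnd_simp.
rewrite /scale.
have {}le_I : e * mean_tail b (e * x) <= mean_tail b x.
  by move: le_I; rewrite -mulrA mulrCA ler_pM2l.
rewrite mulrAC ler_pdivlMr//.
move: (mean_tail b (e * x)) (mean_tail b x) (exponent true b x) le_I s8 => u v w *; lra.
Qed.

Lemma above_rate_le_exponent kd b x : tame kd b -> 0 < x ->
  above_rate X b x <= 16 * exponent kd b x.
Proof.
move=> H x0; have s8 := scale_le_exponent H x0; move: H s8; rewrite /scale; case: kd => H s8.
  (* Only the first cell is kept: x / 2 times the tail at x is below the integral, and 16 is twice
     the 8 of [scale_le_exponent]. *)
  have := @dyadic_sum_le_integral R (above_rate X b) (tail Pi b) x x0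
    (tail_fin b) (above_rate_ge0 X b) (fun y z => @le_above_rate _ _ _ _ _ LX b y z) 1.
  rewrite int_tail_fin// lee_fin big_ord1 expr1 expr0 divr1 -mulrA ler_pM2l//.
  move: (above_rate X b x) (mean_tail b x) (exponent true b x) s8 => u v w *; lra.
have := exponent_ge0 H x0; move: (exponent _ _ _) s8 => u; lra.
Qed.

Hypothesis tails_y : forall b, tail Pi b x @[x --> 0^'+] --> +oo%E.

Lemma above_rate_y b : above_rate X b x @[x --> 0^'+] --> +oo.
Proof.
apply/cvgryPge => A; have /cvgeyPge/(_ A) := tails_y b.
move=> H; near=> x; have x0 : 0 < x by near: x; exact: nbhs_right_gt.
by rewrite -lee_fin -tail_fin//; near: x.
Unshelve. all: by end_near. Qed.

Lemma exponent_y kd b : tame kd b -> exponent kd b x @[x --> 0^'+] --> +oo.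
Proof.
move=> H; apply/cvgryPge => A; have /cvgryPge/(_ (16 * A)) := above_rate_y b.
move=> HA; near=> x; have x0 : 0 < x by near: x; exact: nbhs_right_gt.
have := above_rate_le_exponent H x0.
have : 16 * A <= above_rate X b x by near: x.
by move: (above_rate _ _ _) (exponent _ _ _) => u v; lra.
Unshelve. all: by end_near. Qed.

Lemma ratio_criterion kp km b : tame kp b -> tame km (~~ b) ->
  cvg_in_probability_0 P (fun t w => (extent X km (~~ b) t w / extent X kp b t w)%E) <->
  forall e, 0 < e -> exponent km (~~ b) (e * x) / exponent kp b x @[x --> 0^'+] --> 0.
Proof.
move=> Hp Hm.
have mp x t := @measurable_cutoff _ _ _ _ _ LX kp b x t.
have mm x t := @measurable_cutoff _ _ _ _ _ LX km (~~ b) x t.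
have Mp x t (x0 : 0 < x) (t0 : 0 < t) := @mean_cutoff _ _ _ _ _ LX kp b x t x0 t0 _ (exponent_cvg Hp x0).
have Mm x t (x0 : 0 < x) (t0 : 0 < t) := @mean_cutoff _ _ _ _ _ LX km (~~ b) x t x0 t0 _ (exponent_cvg Hm x0).
have Mpm x y t (x0 : 0 < x) (y0 : 0 < y) (t0 : 0 < t) :=
  @mean_cutoffM _ _ _ _ _ LX kp km b x y t _ _ x0 y0 t0 (exponent_cvg Hp x0) (exponent_cvg Hm y0).
have gp t w := @extent_ge0 _ _ _ _ X kp b t w.
have gm t w := @extent_ge0 _ _ _ _ X km (~~ b) t w.
have ni x y := @exponent_ni kp b x y Hp.
split.
  move=> C; apply: (cvg_ratio_necessary gp gm mp mm Mp Mpm) => //.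
  - by move=> x; exact: exponent_ge0.
  - exact: exponent_y.
move=> C; apply: (cvg_ratio_sufficient gp gm mp mm Mp Mm) => //.
exact: exponent_y.
Qed.

Let exponent_gt0 kd b : tame kd b -> \forall x \near 0^'+, 0 < exponent kd b x.
Proof. by move=> H; have /cvgryPgt/(_ 0) := exponent_y H. Qed.

Lemma scale_gt0 kd b : tame kd b -> \forall x \near 0^'+, 0 < scale kd b x.
Proof.
move=> H; near=> x; have x0 : 0 < x by near: x; exact: nbhs_right_gt.
have : 0 < exponent kd b x by near: x; exact: exponent_gt0.
have := exponent_le_scale H x0; move: (exponent _ _ _) (scale _ _ _) => u v; lra.
Unshelve. all: by end_near. Qed.

(** 32 is 4 times 8: numerator and denominator are compared in opposite directions. *)
Lemma exponent_scale_cvg kp km b b' e : tame kp b -> tame km b' -> 0 < e ->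
  (exponent km b' (e * x) / exponent kp b x @[x --> 0^'+] --> 0) <->
  (scale km b' (e * x) / scale kp b x @[x --> 0^'+] --> 0).
Proof.
move=> Hp Hm e0; split; apply: (@cvg0_dominated _ _ _ _ _ 32); near=> x;
  have x0 : 0 < x by near: x; exact: nbhs_right_gt.
all: have ex0 : 0 < e * x by rewrite mulr_gt0.
all: have ep0 : 0 < exponent kp b x by near: x; exact: exponent_gt0.
all: have sp0 : 0 < scale kp b x by near: x; exact: scale_gt0.
all: have em0 := exponent_ge0 Hm ex0.
all: have em := exponent_le_scale Hm ex0; have sm := scale_le_exponent Hm ex0.
all: have ep := exponent_le_scale Hp x0; have sp := scale_le_exponent Hp x0.
all: move: em0 em sm ep0 sp0 ep sp.
all: move: (exponent km _ _) (scale km _ _) (exponent kp _ _) (scale kp _ _).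
all: move=> em sm ep sp em0 em_le sm_le ep0 sp0 ep_le sp_le.
all: have sm0 : 0 <= sm by lra.
all: apply/andP; split; first by apply: divr_ge0 => //; exact: ltW.
all: rewrite mulrA ler_pdivrMr// mulrAC ler_pdivlMr//.
- have := ler_pM sm0 (ltW ep0) sm_le ep_le; lra.
- have := ler_pM em0 (ltW sp0) em_le sp_le; lra.
Unshelve. all: by end_near. Qed.

(** For e >= 1 monotonicity suffices. For e < 1, [exponent_scale] absorbs e in the numerator if that
    is a sum, and otherwise in the denominator after replacing x by e x. *)
Lemma exponent_cvg_one kp km b b' : tame kp b -> tame km b' -> kp || km ->
  (forall e, 0 < e -> exponent km b' (e * x) / exponent kp b x @[x --> 0^'+] --> 0) <->
  (exponent km b' x / exponent kp b x @[x --> 0^'+] --> 0).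
Proof.
move=> Hp Hm kpm; split=> [/(_ 1 ltr01)|C e e0].
  by apply: eq_cvg0 => x; rewrite (mul1r x).
have [e1|e1] := leP 1 e.
  apply: (@cvg0_dominated _ _ _ _ _ (1) _ C); near=> x.
  have x0 : 0 < x by near: x; exact: nbhs_right_gt.
  have ep0 : 0 < exponent kp b x by near: x; exact: exponent_gt0.
  have ex0 : 0 < e * x by rewrite mulr_gt0.
  have em0 := exponent_ge0 Hm ex0.
  have xex : x <= e * x by rewrite ler_peMl// ltW.
  have := exponent_ni Hm x0 xex; move: em0 ep0.
  move: (exponent km b' (e * x)) (exponent km b' x) (exponent kp b x) => u v p u0 p0 uv.
  by rewrite divr_ge0 ?(ltW p0)//= mul1r ler_pM2r ?invr_gt0.
case: km Hm kpm C => Hm kpm C.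
  apply: (@cvg0_dominated _ _ _ _ _ (32 / e) _ C); near=> x.
  have x0 : 0 < x by near: x; exact: nbhs_right_gt.
  have ep0 : 0 < exponent kp b x by near: x; exact: exponent_gt0.
  have ex0 : 0 < e * x by rewrite mulr_gt0.
  have em0 := exponent_ge0 Hm ex0.
  have := exponent_scale Hm x0 e0 (ltW e1); move: em0 ep0.
  move: (exponent true b' (e * x)) (exponent true b' x) (exponent kp b x) => u v p u0 p0 uv.
  by rewrite divr_ge0 ?(ltW p0)//= mulrA ler_pM2r ?invr_gt0.
case: kp Hp kpm C => [Hp _ C|Hp kpm]; last discriminate kpm.
have Ce : exponent false b' (e * x) / exponent true b (e * x) @[x --> 0^'+] --> 0.
  apply/cvgr0Pnorm_lt => eta eta0; move/cvgr0Pnorm_lt/(_ _ eta0): C => [r /= r0 Hr].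
  exists (r / e); first by rewrite /= divr_gt0.
  move=> x /=; rewrite sub0r normrN => xr x0.
  apply: Hr; last by rewrite mulr_gt0.
  by rewrite /= sub0r normrN normrM (gtr0_norm e0) mulrC -ltr_pdivlMr.
have epe : \forall x \near 0^'+, 0 < exponent true b (e * x).
  have [r /= r0 Hr] := exponent_gt0 Hp; exists (r / e); first by rewrite /= divr_gt0.
  move=> x /=; rewrite sub0r normrN => xr x0.
  apply: Hr; last by rewrite mulr_gt0.
  by rewrite /= sub0r normrN normrM (gtr0_norm e0) mulrC -ltr_pdivlMr.
apply: (@cvg0_dominated _ _ _ _ _ (32 / e) _ Ce).
apply: (filterS _ (filterI (nbhs_right_gt 0) (filterI (exponent_gt0 Hp) epe))) => x [x0 [ep0 epe0]].
have ex0 : 0 < e * x by rewrite mulr_gt0.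
have em0 := exponent_ge0 Hm ex0.
have H := exponent_scale Hp x0 e0 (ltW e1).
move: em0 ep0 epe0 H.
move: (exponent true b (e * x)) (exponent true b x) (exponent false b' (e * x)).
move=> pe p u u0 p0 pe0 H; rewrite divr_ge0 ?(ltW p0)//= [leRHS]mulrCA ler_wpM2l//.
by rewrite ler_pdivlMr// mulrC ler_pdivrMr.
Unshelve. all: by end_near. Qed.

Lemma ratio_criterion_one kp km b : tame kp b -> tame km (~~ b) -> kp || km ->
  cvg_in_probability_0 P (fun t w => (extent X km (~~ b) t w / extent X kp b t w)%E) <->
  (scale km (~~ b) x / scale kp b x @[x --> 0^'+] --> 0).
Proof.
move=> Hp Hm kpm; rewrite (ratio_criterion Hp Hm) (exponent_cvg_one Hp Hm kpm).
have [H1 H2] := exponent_scale_cvg Hp Hm ltr01.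
split=> H.
- apply: eq_cvg0 (H1 _) => [x|]; first by rewrite (mul1r x).
  by apply: eq_cvg0 H => x; rewrite (mul1r x).
- apply: eq_cvg0 (H2 _) => [x|]; first by rewrite (mul1r x).
  by apply: eq_cvg0 H => x; rewrite (mul1r x).
Qed.

Lemma fin_ratio (u v : R) : 0 < v -> (u%:E / v%:E = (u / v)%:E)%E.
Proof. by move=> v0; rewrite inver gt_eqF. Qed.

End Exponents.

Theorem theorem4 (d : measure_display) (T : measurableType d) (R : realType)
    (P : probability T R) (X : R -> {RV P >-> R})
    (Pi : {measure set (measurableTypeR R) -> \bar R})
    (X_levy : levy_process X) (X_Pi : levy_measure_of P X Pi)
    (Pi_pos_infty : tail_pos Pi x @[x --> 0^'+] --> +oo%E)
    (Pi_neg_infty : tail_neg Pi x @[x --> 0^'+] --> +oo%E) :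
  let sum_pos := sum_upto (jump_pos X) in
  let sum_neg := sum_upto (jump_neg X) in
  let sup_pos := sup_upto (jump_pos X) in
  let sup_neg := sup_upto (jump_neg X) in
  let sum_pos_finite :=
    forall t : R, 0 < t -> {ae P, forall w, (sum_pos t w < +oo)%E} in
  let sum_neg_finite :=
    forall t : R, 0 < t -> {ae P, forall w, (sum_neg t w < +oo)%E} in
  [/\ sum_neg_finite ->
        (cvg_in_probability_0 P (fun t w => (sum_neg t w / sup_pos t w)%E) <->
         (int_tail (tail_neg Pi) x / (x%:E * tail_pos Pi x))%E
           @[x --> 0^'+] --> 0%E),
      sum_pos_finite ->
        (cvg_in_probability_0 P (fun t w => (sup_neg t w / sum_pos t w)%E) <->
         (x%:E * tail_neg Pi x / int_tail (tail_pos Pi) x)%E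
           @[x --> 0^'+] --> 0%E),
      sum_neg_finite -> sum_pos_finite ->
        (cvg_in_probability_0 P (fun t w => (sum_neg t w / sum_pos t w)%E) <->
         (int_tail (tail_neg Pi) x / int_tail (tail_pos Pi) x)%E
           @[x --> 0^'+] --> 0%E)
    & cvg_in_probability_0 P (fun t w => (sup_neg t w / sup_pos t w)%E) <->
      forall e : R, 0 < e ->
        (tail_neg Pi (e * x) / tail_pos Pi x)%E @[x --> 0^'+] --> 0%E].
Proof.
move=> sum_pos sum_neg sup_pos sup_neg sum_pos_finite sum_neg_finite.
have tails_y b : tail Pi b x @[x --> 0^'+] --> +oo%E by case: b.
have tP y : 0 < y -> tail_pos Pi y = (above_rate X true y)%:E.
  by move=> y0; rewrite -(above_rateE X_levy)// -(tailE X_levy X_Pi).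
have tN y : 0 < y -> tail_neg Pi y = (above_rate X false y)%:E.
  by move=> y0; rewrite -(above_rateE X_levy)// -(tailE X_levy X_Pi).
have supt b : tame X false b by [].
have iP : sum_pos_finite -> tame X true true by move=> + _; apply.
have iN : sum_neg_finite -> tame X true false by move=> + _; apply.
have int b y := @int_tail_fin _ _ _ _ X Pi X_levy X_Pi b y.
split=> [fn|fp|fn fp|]; [have tn := iN fn|have tp := iP fp|have tn := iN fn; have tp := iP fp|].
- rewrite (ratio_criterion_one X_levy X_Pi tails_y (supt true) tn)//.
  symmetry; apply: cvg_EFin_near; near=> x.
  have x0 : 0 < x by near: x; exact: nbhs_right_gt.
  have s0 : 0 < scale X Pi false true x by near: x; exact: (scale_gt0 X_levy X_Pi).
  (* [mean_tail] is the integral divided by x, so a factor x cancels. *)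
  rewrite (int false)// tP// -EFinM fin_ratio ?mulr_gt0//.
  by rewrite -mulf_div divff ?gt_eqF// mul1r.
- rewrite (ratio_criterion_one X_levy X_Pi tails_y tp (supt false))//.
  symmetry; apply: cvg_EFin_near; near=> x.
  have x0 : 0 < x by near: x; exact: nbhs_right_gt.
  have s0 : 0 < scale X Pi true true x by near: x; exact: (scale_gt0 X_levy X_Pi).
  have xs0 : 0 < x * mean_tail Pi true x by exact: mulr_gt0 x0 s0.
  rewrite (int true)// tN// -EFinM fin_ratio//.
  by rewrite -mulf_div divff ?gt_eqF// mul1r.
- rewrite (ratio_criterion_one X_levy X_Pi tails_y tp tn)//.
  symmetry; apply: cvg_EFin_near; near=> x.
  have x0 : 0 < x by near: x; exact: nbhs_right_gt.
  have s0 : 0 < scale X Pi true true x by near: x; exact: (scale_gt0 X_levy X_Pi).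
  have xs0 : 0 < x * mean_tail Pi true x by exact: mulr_gt0 x0 s0.
  rewrite (int true)// (int false)// fin_ratio//.
  by rewrite -mulf_div divff ?gt_eqF// mul1r.
rewrite (ratio_criterion X_levy X_Pi tails_y (supt true) (supt false)).
(* With suprema on both sides the comparison of exponents and tails is made separately for each
   e. *)
have main e : 0 < e ->
  ((tail_neg Pi (e * x) / tail_pos Pi x)%E @[x --> 0^'+] --> 0%E <->
   (exponent X false false (e * x) / exponent X false true x @[x --> 0^'+] --> 0)).
  move=> e0; rewrite (exponent_scale_cvg X_levy X_Pi tails_y (supt true) (supt false) e0).
  apply: cvg_EFin_near; near=> x.
  have x0 : 0 < x by near: x; exact: nbhs_right_gt.
  have s0 : 0 < scale X Pi false true x by near: x; exact: (scale_gt0 X_levy X_Pi).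
  by rewrite tP// tN ?mulr_gt0// fin_ratio.
by split=> H e e0; apply/(main e e0); exact: H.
Unshelve. all: by end_near. Qed.
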